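(* With the complexes $\mathrm{Pasc}(I)$, the partial compositions $\circ_i$ and the unit $e^{\{1\}}_1\in\mathrm{Pasc}(\{1\})$ described in the context, $\mathrm{Pasc}$ is a (symmetric) differential graded operad, i.e. an operad in the symmetric monoidal category of complexes of $\mathbb{Z}$-modules.
   Context: Operads are viewed as functors on the groupoid of finite non-empty sets, with partial compositions $\circ_i:\mathcal P(I)\otimes \mathcal P(J)\to \mathcal P((I\setminus\{i\})\sqcup J)$ for $i\in I$; the category of complexes of $\mathbb{Z}$-modules carries the usual Koszul sign in its symmetry. Definition of $\mathrm{Pasc}$. For a finite non-empty set $I$, let $\mathbb{Z}^I$ be free with basis $(e^I_i)_{i\in I}$ and let $\mathrm{Ex}(I)$ be the unital exterior algebra on $\mathbb{Z}^I$ with its standard grading. For $i\in I$ let $\theta^I_i$ be the (left) derivation of degree $-1$ of $\mathrm{Ex}(I)$ with $\theta^I_i(e^I_j)=\delta_{ij}$. Equip $\mathrm{Ex}(I)$ with the differential $d(x)=\sum_{i\in I}\theta_i^I(x)$ of degree $-1$. Then $\mathrm{Pasc}(I)$ is the quotient complex of $\mathrm{Ex}(I)$ by the span of the unit, with shifted grading $\dim(\pm\wedge_{i\in P}e^I_i)=\mathrm{Card}(P)-1$ for $P\subset I$ non-empty. Bijections act by relabelling. The map induced by $\theta^I_i$ on the quotient is still denoted $\theta_i^I$. Composition. Let $I,J$ be finite non-empty sets, $P=\{i_1,\dots,i_p\}\subset I$ and $Q=\{j_1,\dots,j_q\}\subset J$ non-empty subsets, $i\in I$, $x=e^I_{i_1}\wedge\dots\wedge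 e^I_{i_p}$ and $y=e^J_{j_1}\wedge\dots\wedge e^J_{j_q}$. Then $x\circ_i y\in\mathrm{Pasc}((I\setminus\{i\})\sqcup J)$ is $$x\circ_i y=\begin{cases}(-1)^{\dim (x)}\,\theta^{I\sqcup J}_i(x\wedge y)&\text{if } i\in P,\\ x&\text{if } i\notin P\text{ and }\dim y=0,\\ 0&\text{if } i\notin P\text{ and }\dim y>0,\end{cases}$$ where exterior products are transported between exterior algebras via the canonical identifications of basis elements. *)

(* Defs.v *)
From HB Require Import structures.
From mathcomp Require Import all_boot all_order all_algebra.
From mathcomp Require Import generic_quotient ring_quotient.

Set Implicit Arguments.
Unset Strict Implicit.
Unset Printing Implicit Defensive.

Import Order.TTheory GRing.Theory Num.Theory.
Local Open Scope ring_scope.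
Local Open Scope quotient_scope.

Record fnset := FNSet { fnset_fin :> finType; fnset_gt0 : (0 < #|fnset_fin|)%N }.

Record bij (A B : Type) := Bij {
  bfun :> A -> B;
  binv : B -> A;
  bfunK : cancel bfun binv;
  binvK : cancel binv bfun }.

Definition bij_id (A : Type) : bij A A :=
  @Bij A A id id (fun=> erefl) (fun=> erefl).

Definition bij_comp (A B C : Type) (g : bij B C) (f : bij A B) : bij A C :=
  @Bij A C (g \o f) (binv f \o binv g)
    (can_comp (bfunK g) (bfunK f)) (can_comp (binvK f) (binvK g)).

Definition one_set : fnset := @FNSet unit (eq_leq (esym card_unit)).

Definition ins_type (I J : finType) (i : I) : finType :=
  ({x : I | x != i} + J)%type.
Arguments ins_type {I} J i.

Lemma ins_gt0 (I : finType) (J : fnset) (i : I) : (0 < #|ins_type J i|)%N.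
Proof. by rewrite card_sum addn_gt0 (fnset_gt0 J) orbT. Qed.

Definition ins (I J : fnset) (i : I) : fnset := FNSet (ins_gt0 J i).
Arguments ins {I} J i.

Section InsBij.
Variables (I I' J J' : finType) (f : bij I I') (g : bij J J') (i : I).

Lemma bij_neq (x y : I) : x != y -> f x != f y.
Proof. by rewrite (inj_eq (can_inj (bfunK f))). Qed.

Lemma binv_neq (x : I') : x != f i -> binv f x != i.
Proof. by apply: contraNneq => <-; rewrite binvK. Qed.

Definition ins_fun (x : ins_type J i) : ins_type J' (f i) :=
  match x with
  | inl (exist a p) => inl (exist _ (f a) (bij_neq p))
  | inr b => inr (g b)
  end.

Definition ins_inv (x : ins_type J' (f i)) : ins_type J i :=
  match x with
  | inl (exist a p) => inl (exist _ (binv f a) (binv_neq p))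
  | inr b => inr (binv g b)
  end.

Lemma ins_funK : cancel ins_fun ins_inv.
Proof.
by case=> [[a p]|b] /=; [congr inl; apply: val_inj; rewrite /= bfunK
                        | rewrite bfunK].
Qed.

Lemma ins_invK : cancel ins_inv ins_fun.
Proof.
by case=> [[a p]|b] /=; [congr inl; apply: val_inj; rewrite /= binvK
                        | rewrite binvK].
Qed.

Definition ins_bij : bij (ins_type J i) (ins_type J' (f i)) :=
  Bij ins_funK ins_invK.
End InsBij.

(* ((I \ {i}) + J) \ {j} + K  ~  (I \ {i}) + ((J \ {j}) + K) *)
Section SeqBij.
Variables (I J K : finType) (i : I) (j : J).

Definition seq_fun (x : ins_type K (inr j : ins_type J i)) :
    ins_type (ins_type K j) i :=
  match x with
  | inl (exist (inl a) _) => inl a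
  | inl (exist (inr b) p) => inr (inl (exist _ b p))
  | inr c => inr (inr c)
  end.

Definition seq_inv (x : ins_type (ins_type K j) i) :
    ins_type K (inr j : ins_type J i) :=
  match x with
  | inl a => inl (exist _ (inl a) isT)
  | inr (inl (exist b p)) => inl (exist _ (inr b) p)
  | inr (inr c) => inr c
  end.

Lemma seq_funK : cancel seq_fun seq_inv.
Proof. by case=> [[[a|b] p]|c] //=; congr inl; apply: val_inj. Qed.

Lemma seq_invK : cancel seq_inv seq_fun.
Proof. by case=> [a|[[b p]|c]]. Qed.

Definition seq_bij : bij (ins_type K (inr j : ins_type J i))
                         (ins_type (ins_type K j) i) :=
  Bij seq_funK seq_invK.
End SeqBij.

(* ((I \ {i}) + J) \ {k} + K  ~  ((I \ {k}) + K) \ {i} + J, for i != k in I *)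
Section ParBij.
Variables (I : finType) (i k : I) (ki : k != i) (ik : i != k).

Definition keepl (J : finType) (a b : I) (ba : b != a) : ins_type J a :=
  inl (exist _ b ba).

Definition par_fun (J K : finType) (a b : I) (ba : b != a) (ab : a != b)
    (x : ins_type K (keepl J ba)) : ins_type J (keepl K ab) :=
  match x with
  | inl (exist (inl (exist c ca)) cb) =>
      inl (exist _ (inl (exist _ c cb)) ca)
  | inl (exist (inr y) _) => inr y
  | inr z => inl (exist _ (inr z) isT)
  end.

Lemma par_funK (J K : finType) (a b : I) (ba : b != a) (ab : a != b) :
  cancel (@par_fun J K a b ba ab) (@par_fun K J b a ab ba).
Proof.
by case=> [[[[c ca]|y] p]|z] //=; congr inl; apply: val_inj.
Qed.

Definition par_bij (J K : finType) :
    bij (ins_type K (keepl J ki)) (ins_type J (keepl K ik)) :=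
  Bij (@par_funK J K i k ki ik) (@par_funK K J k i ik ki).
End ParBij.

Section UnitBij.
Variables (I J : finType) (i : I).

Definition unitl_fun (x : ins_type J tt) : J :=
  match x with
  | inl (exist tt p) => match notF p with end
  | inr b => b
  end.

Lemma unitl_funK : cancel unitl_fun inr.
Proof. by case=> [[[] p]|b]. Qed.

Definition unitl_bij : bij (ins_type J tt) J :=
  @Bij _ _ unitl_fun inr unitl_funK (fun=> erefl).

Definition unitr_fun (x : ins_type unit i) : I :=
  match x with inl a => val a | inr _ => i end.

Definition unitr_inv (x : I) : ins_type unit i :=
  if insub x is Some a then inl a else inr tt.

Lemma unitr_funK : cancel unitr_fun unitr_inv.
Proof.
by case=> [a|[]] /=; rewrite /unitr_inv ?valK // insubF ?eqxx.
Qed.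

Lemma unitr_invK : cancel unitr_inv unitr_fun.
Proof.
by move=> x; rewrite /unitr_inv; case: insubP => [a _ //|/negPn/eqP->].
Qed.

Definition unitr_bij : bij (ins_type unit i) I := Bij unitr_funK unitr_invK.
End UnitBij.

(* A graded module is an abelian group with subgroups of homogeneous elements
   of which it is the internal direct sum; the latter is part of
   [is_complex].  Additive maps of abelian groups are the Z-linear ones. *)
Record dgmod := DGMod {
  dg_mod :> zmodType;
  dg_hom : int -> dg_mod -> Prop;
  dg_d : dg_mod -> dg_mod }.
Arguments dg_hom {d}.
Arguments dg_d {d}.

Record is_complex (C : dgmod) : Prop := IsComplex {
  hom_0 : forall n, dg_hom n (0 : C);
  hom_B : forall n (x y : C), dg_hom n x -> dg_hom n y -> dg_hom n (x - y);
  hom_span : forall x : C, exists (r : seq int) (c : int -> C),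
    (forall n, dg_hom n (c n)) /\ x = \sum_(n <- r) c n;
  hom_direct : forall (r : seq int) (c : int -> C), uniq r ->
    (forall n, dg_hom n (c n)) -> \sum_(n <- r) c n = 0 ->
    forall n, n \in r -> c n = 0;
  d_add : {morph @dg_d C : x y / x + y};
  d_hom : forall n (x : C), dg_hom n x -> dg_hom (n - 1) (dg_d x);
  d_d : forall x : C, dg_d (dg_d x) = 0 }.

Record is_chain_map (C D : dgmod) (f : C -> D) : Prop := IsChainMap {
  map_add : {morph f : x y / x + y};
  map_hom : forall n (x : C), dg_hom n x -> dg_hom n (f x);
  map_d : forall x : C, f (dg_d x) = dg_d (f x) }.

(* [f] induces a morphism of complexes from the tensor product of C and D. *)
Record is_chain_bimap (C D E : dgmod) (f : C -> D -> E) : Prop := IsChainBimap {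
  bimap_addl : forall y, {morph f^~ y : x x' / x + x'};
  bimap_addr : forall x, {morph f x : y y' / y + y'};
  bimap_hom : forall m n (x : C) (y : D),
    dg_hom m x -> dg_hom n y -> dg_hom (m + n) (f x y);
  bimap_d : forall m (x : C) (y : D), dg_hom m x ->
    dg_d (f x y) = f (dg_d x) y + f x (dg_d y) *~ (-1) ^ m }.

Record operad_data := OperadData {
  op :> fnset -> dgmod;
  op_act : forall I J : fnset, bij I J -> op I -> op J;
  op_comp : forall (I J : fnset) (i : I), op I -> op J -> op (ins J i);
  op_one : op one_set }.
Arguments op_act {o I J}.
Arguments op_comp {o I J}.
Arguments op_one {o}.

Record is_dg_operad (P : operad_data) : Prop := IsDGOperad {
  op_complex : forall I, is_complex (P I);
  op_act_chain : forall (I J : fnset) (f : bij I J),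
    is_chain_map (op_act f : P I -> P J);
  op_act_ext : forall (I J : fnset) (f g : bij I J) (x : P I),
    f =1 g -> op_act f x = op_act g x;
  op_act_id : forall (I : fnset) (x : P I), op_act (bij_id I) x = x;
  op_act_comp : forall (I J K : fnset) (g : bij J K) (f : bij I J) (x : P I),
    op_act (bij_comp g f) x = op_act g (op_act f x);
  op_comp_chain : forall (I J : fnset) (i : I),
    is_chain_bimap (op_comp i : P I -> P J -> P (ins J i));
  op_comp_nat : forall (I I' J J' : fnset) (f : bij I I') (g : bij J J')
      (i : I) (x : P I) (y : P J),
    op_act (ins_bij f g i : bij (ins J i) (ins J' (f i))) (op_comp i x y) =
    op_comp (f i) (op_act f x) (op_act g y);
  op_one_hom : dg_hom 0 (op_one : P one_set);
  op_one_d : dg_d (op_one : P one_set) = 0;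
  op_comp_seq : forall (I J K : fnset) (i : I) (j : J)
      (x : P I) (y : P J) (z : P K),
    op_act (seq_bij K i j : bij (ins K (inr j : ins J i)) (ins (ins K j) i))
      (op_comp (inr j : ins J i) (op_comp i x y) z) =
    op_comp i x (op_comp j y z);
  op_comp_par : forall (I J K : fnset) (i k : I) (ki : k != i) (ik : i != k)
      (m n : int) (x : P I) (y : P J) (z : P K),
    dg_hom m y -> dg_hom n z ->
    op_act (par_bij ki ik J K
              : bij (ins K (keepl J ki : ins J i)) (ins J (keepl K ik : ins K k)))
      (op_comp (keepl J ki : ins J i) (op_comp i x y) z) =
    op_comp (keepl K ik : ins K k) (op_comp k x z) y *~ (-1) ^ (m * n);
  op_comp_1l : forall (J : fnset) (y : P J),
    op_act (unitl_bij J : bij (ins J (tt : one_set)) J)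
      (op_comp (tt : one_set) op_one y) = y;
  op_comp_1r : forall (I : fnset) (i : I) (x : P I),
    op_act (unitr_bij i : bij (ins one_set i) I) (op_comp i x op_one) = x }.

(* The model: the free abelian group on the subsets of I, the subset P standing
   for the exterior product of the e_i, i in P, in the order of [enum I].  The
   lemmas [gen_sq], [gen_anti], [lift_gen], [liftM] and [lift_unique] give its
   universal property. *)
Definition Ex (I : finType) : Type := {ffun {set I} -> int}.
HB.instance Definition _ (I : finType) :=
  GRing.Zmodule.copy (Ex I) {ffun {set I} -> int}.

Section Linear.
Variables (I J : finType) (V : zmodType).

Definition lin (f : {set I} -> V) (x : Ex I) : V := \sum_P f P *~ x P.

Definition bilin (f : {set I} -> {set J} -> V) (x : Ex I) (y : Ex J) : V :=
  \sum_P \sum_Q f P Q *~ (x P * y Q).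
End Linear.

Definition bas (I : finType) (P : {set I}) : Ex I := [ffun Q => (Q == P)%:R].

Definition nlt (I : finType) (i : I) (P : {set I}) : nat :=
  #|[set j in P | (enum_rank j < enum_rank i)%N]|.

Definition ninv (I : finType) (P Q : {set I}) : nat := \sum_(i in P) nlt i Q.

(* [ninv P Q] is the number of inversions sorting P followed by Q. *)
Definition Ex_mul (I : finType) : Ex I -> Ex I -> Ex I :=
  bilin (fun P Q => if [disjoint P & Q]
                    then bas (P :|: Q) *~ (-1) ^+ ninv P Q else 0).

Section LinearAdditive.
Variables (I : finType) (V : zmodType).

Lemma exD (x y : Ex I) P : (x + y) P = x P + y P.
Proof. exact: ffunE. Qed.

Lemma exN (x : Ex I) P : (- x) P = - x P.
Proof. exact: ffunE. Qed.

Lemma exMz (x : Ex I) n P : (x *~ n) P = x P *~ n.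
Proof.
have exMn k : (x *+ k) P = x P *+ k.
  by elim: k => [|k IHk]; rewrite ?ffunE // !mulrS exD IHk.
by case: n => k; rewrite ?NegzE ?mulrNz ?exN -!pmulrn exMn.
Qed.

Lemma lin_is_zmod_morphism (f : {set I} -> V) : zmod_morphism (lin f).
Proof.
move=> x y; rewrite /lin -sumrB; apply: eq_bigr => P _.
by rewrite exD exN mulrzBr.
Qed.
HB.instance Definition _ (f : {set I} -> V) :=
  GRing.isZmodMorphism.Build (Ex I) V (lin f) (lin_is_zmod_morphism f).
End LinearAdditive.

Section LinearTheory.
Variables (I : finType) (V : zmodType).

Lemma bas_eq (P : {set I}) : bas P P = 1.
Proof. by rewrite ffunE eqxx. Qed.

Lemma bas_neq (P Q : {set I}) : Q != P -> bas P Q = 0.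
Proof. by rewrite ffunE => /negPf->. Qed.

Lemma lin_bas (f : {set I} -> V) P : lin f (bas P) = f P.
Proof.
rewrite /lin (bigD1 P) //= bas_eq mulr1z big1 ?addr0 // => Q nQP.
by rewrite bas_neq ?mulr0z.
Qed.

End LinearTheory.

Lemma ex_decomp (I : finType) (x : Ex I) : x = \sum_P bas P *~ x P.
Proof.
apply/ffunP=> Q; have eval (z : Ex I) : z Q = lin (fun P => (P == Q)%:R : int) z.
  rewrite /lin (bigD1 Q) //= eqxx -mulrzl intz mulr1 big1 ?addr0 // => P.
  by move/negPf->; rewrite mul0rz.
rewrite [RHS]eval raddf_sum (bigD1 Q) //=.
rewrite raddfMz /= lin_bas eqxx -mulrzl intz mulr1 big1 ?addr0 // => P nPQ.
by rewrite raddfMz /= lin_bas (negPf nPQ) mul0rz.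
Qed.

Section BilinearTheory.
Variables (I J : finType) (V : zmodType).

Lemma additive_eq (f g : {additive Ex I -> V}) :
  (forall P, f (bas P) = g (bas P)) -> f =1 g.
Proof.
move=> fg x; rewrite (ex_decomp x) !raddf_sum; apply: eq_bigr => P _.
by rewrite !raddfMz /= fg.
Qed.

Lemma bilinE (f : {set I} -> {set J} -> V) x y :
  bilin f x y = lin (fun P => lin (f P) y) x.
Proof.
apply: eq_bigr => P _; rewrite /lin mulrz_suml; apply: eq_bigr => Q _.
by rewrite mulrC mulrzA.
Qed.

Lemma bilinE' (f : {set I} -> {set J} -> V) x y :
  bilin f x y = lin (fun Q => lin (f^~ Q) x) y.
Proof.
rewrite /bilin exchange_big; apply: eq_bigr => P _.
by rewrite /lin mulrz_suml; apply: eq_bigr => Q _; rewrite mulrzA.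
Qed.

Lemma bilin_bas (f : {set I} -> {set J} -> V) P Q :
  bilin f (bas P) (bas Q) = f P Q.
Proof. by rewrite bilinE !lin_bas. Qed.

Lemma bilinDl f (y : Ex J) : {morph (@bilin I J V f)^~ y : x x' / x + x'}.
Proof. by move=> x x'; rewrite !bilinE raddfD. Qed.

Lemma bilinDr f (x : Ex I) : {morph @bilin I J V f x : y y' / y + y'}.
Proof. by move=> y y'; rewrite !bilinE' raddfD. Qed.

End BilinearTheory.

Lemma ex_ind (I : finType) (K : Ex I -> Prop) :
    (forall P, K (bas P)) -> (forall x y, K x -> K y -> K (x - y)) ->
  forall x, K x.
Proof.
move=> Kb KB; have K0 : K 0 by rewrite -(subrr (bas set0)); apply: KB.
have KN x : K x -> K (- x) by rewrite -[- x]add0r; apply: KB.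
have KD x y : K x -> K y -> K (x + y) by rewrite -{2}[y]opprK => /KB H /KN /H.
move=> x; rewrite (ex_decomp x); elim/big_ind: _ => // P _.
have Kn n : K (bas P *+ n).
  by elim: n => [|n IHn]; rewrite ?mulr0n // mulrS; apply: KD.
by case: (x P) => n; [apply: Kn | rewrite NegzE mulrNz; apply/KN/Kn].
Qed.

Section ExteriorRing.
Variable I : finType.
Implicit Types (P Q R : {set I}) (x y z : Ex I) (i j : I).

Lemma nltE i P : nlt i P = (\sum_(j in P) (enum_rank j < enum_rank i))%N.
Proof.
rewrite /nlt -sum1_card big_mkcond [RHS]big_mkcond; apply: eq_bigr => j _.
by rewrite inE; case: (j \in P); case: (_ < _)%N.
Qed.

Lemma nlt0 i : nlt i set0 = 0%N.
Proof. by rewrite nltE big_set0. Qed.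

Lemma sumU P Q (F : I -> nat) : [disjoint P & Q] ->
  (\sum_(i in P :|: Q) F i = \sum_(i in P) F i + \sum_(i in Q) F i)%N.
Proof.
by move=> dPQ; rewrite -bigU //; apply: eq_bigl => i; rewrite !inE.
Qed.

Lemma nltU i P Q : [disjoint P & Q] -> nlt i (P :|: Q) = (nlt i P + nlt i Q)%N.
Proof. by move=> dPQ; rewrite !nltE sumU. Qed.

Lemma ninv0P P : ninv set0 P = 0%N.
Proof. by rewrite /ninv big_set0. Qed.

Lemma ninvP0 P : ninv P set0 = 0%N.
Proof. by rewrite /ninv big1 // => i _; rewrite nlt0. Qed.

Lemma ninvUl P Q R :
  [disjoint P & Q] -> ninv (P :|: Q) R = (ninv P R + ninv Q R)%N.
Proof. by move=> dPQ; rewrite /ninv sumU. Qed.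

Lemma ninvUr P Q R :
  [disjoint Q & R] -> ninv P (Q :|: R) = (ninv P Q + ninv P R)%N.
Proof.
move=> dQR; rewrite /ninv -big_split; apply: eq_bigr => i _.
by rewrite nltU.
Qed.

Lemma ex_mul_bas P Q : Ex_mul (bas P) (bas Q) =
  if [disjoint P & Q] then bas (P :|: Q) *~ (-1) ^+ ninv P Q else 0.
Proof. exact: bilin_bas. Qed.

Fact ex_mulDl : left_distributive (@Ex_mul I) +%R.
Proof. by move=> x y z; apply: bilinDl. Qed.

Fact ex_mulDr : right_distributive (@Ex_mul I) +%R.
Proof. by move=> x y z; apply: bilinDr. Qed.

Lemma ex_mul0x x : Ex_mul 0 x = 0.
Proof. by apply: (addIr (Ex_mul 0 x)); rewrite -ex_mulDl !add0r. Qed.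

Lemma ex_mulx0 x : Ex_mul x 0 = 0.
Proof. by apply: (addIr (Ex_mul x 0)); rewrite -ex_mulDr !add0r. Qed.

Lemma ex_mulBl x y z : Ex_mul (x - y) z = Ex_mul x z - Ex_mul y z.
Proof. by apply/(addIr (Ex_mul y z)); rewrite -ex_mulDl !subrK. Qed.

Lemma ex_mulBr x y z : Ex_mul x (y - z) = Ex_mul x y - Ex_mul x z.
Proof. by apply/(addIr (Ex_mul x z)); rewrite -ex_mulDr !subrK. Qed.

Lemma ex_mulMzl x y n : Ex_mul (x *~ (-1) ^+ n) y = Ex_mul x y *~ (-1) ^+ n.
Proof.
rewrite -signr_odd; case: odd; rewrite ?expr1 ?expr0 ?mulr1z ?mulrN1z //.
by rewrite -[- x]add0r ex_mulBl ex_mul0x add0r.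
Qed.

Lemma ex_mulMzr x y n : Ex_mul x (y *~ (-1) ^+ n) = Ex_mul x y *~ (-1) ^+ n.
Proof.
rewrite -signr_odd; case: odd; rewrite ?expr1 ?expr0 ?mulr1z ?mulrN1z //.
by rewrite -[- y]add0r ex_mulBr ex_mulx0 add0r.
Qed.

Lemma disjointUl P Q R :
  [disjoint P :|: Q & R] = [disjoint P & R] && [disjoint Q & R].
Proof. by rewrite -!setI_eq0 setIUl setU_eq0. Qed.

Lemma disjointUr P Q R :
  [disjoint P & Q :|: R] = [disjoint P & Q] && [disjoint P & R].
Proof. by rewrite -!setI_eq0 setIUr setU_eq0. Qed.

Fact ex_mulA : associative (@Ex_mul I).
Proof.
move=> x y z; move: x y z; apply: ex_ind => [P|? ? H H' *]; last first.
  by rewrite !ex_mulBl H H'.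
apply: ex_ind => [Q|? ? H H' *]; last by rewrite !(ex_mulBl, ex_mulBr) H H'.
apply: ex_ind => [R|? ? H H']; last by rewrite !ex_mulBr H H'.
rewrite !ex_mul_bas.
have [dQR|dQR] := boolP [disjoint Q & R]; have [dPQ|dPQ] := boolP [disjoint P & Q].
- rewrite ex_mulMzl ex_mulMzr !ex_mul_bas disjointUl disjointUr dQR dPQ andbT andTb.
  case: ifP => _; last by rewrite !mul0rz.
  rewrite -!mulrzA -!exprD setUA ninvUl // ninvUr //.
  by rewrite -addnA addnC.
- by rewrite ex_mul0x ex_mulMzr ex_mul_bas disjointUr (negPf dPQ) mul0rz.
- by rewrite ex_mulx0 ex_mulMzl ex_mul_bas disjointUl (negPf dQR) andbF mul0rz.
- by rewrite ex_mul0x ex_mulx0.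
Qed.

Fact ex_mul1x : left_id (bas set0) (@Ex_mul I).
Proof.
apply: ex_ind => [P|x y H H']; last by rewrite ex_mulBr H H'.
by rewrite ex_mul_bas -setI_eq0 set0I eqxx set0U ninv0P.
Qed.

Fact ex_mulx1 : right_id (bas set0) (@Ex_mul I).
Proof.
apply: ex_ind => [P|x y H H']; last by rewrite ex_mulBl H H'.
by rewrite ex_mul_bas -setI_eq0 setI0 eqxx setU0 ninvP0.
Qed.

Fact ex_1neq0 : bas set0 != 0 :> Ex I.
Proof. by apply/eqP => /ffunP/(_ set0)/eqP; rewrite bas_eq ffunE. Qed.

HB.instance Definition _ := GRing.Zmodule_isNzRing.Build (Ex I)
  ex_mulA ex_mul1x ex_mulx1 ex_mulDl ex_mulDr ex_1neq0.
End ExteriorRing.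

Definition gen (I : finType) (i : I) : Ex I := bas [set i].

(* The ring morphism with [gen i |-> v i], if the [v i] have square zero and
   anticommute. *)
Definition ex_lift (I : finType) (A : nzRingType) (v : I -> A) : Ex I -> A :=
  lin (fun P => \prod_(i in P) v i).

Definition Ex_map (I J : finType) (f : I -> J) : Ex I -> Ex J :=
  ex_lift (fun i => gen (f i)).

(* [theta i] is characterized as a derivation by [theta_gen], [thetaB] and
   [theta_deriv]. *)
Definition theta (I : finType) (i : I) : Ex I -> Ex I :=
  lin (fun P => if i \in P then bas (P :\ i) *~ (-1) ^+ nlt i P else 0).

Definition Ex_d (I : finType) (x : Ex I) : Ex I := \sum_i theta i x.

Definition Ex_hom (I : finType) (n : int) (x : Ex I) : Prop :=
  forall P, x P != 0 -> #|P|%:Z = n.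

Section ExteriorTheory.
Variable I : finType.
Implicit Types (P Q R : {set I}) (x y z : Ex I) (i j : I).

Lemma mul_bas P Q : bas P * bas Q =
  if [disjoint P & Q] then bas (P :|: Q) *~ (-1) ^+ ninv P Q else 0.
Proof. exact: ex_mul_bas. Qed.

Lemma bas0 : bas set0 = 1 :> Ex I.
Proof. by []. Qed.

Lemma gen_sq i : gen i * gen i = 0.
Proof. by rewrite mul_bas disjoints1 inE eqxx. Qed.

Lemma ninv1 i P : ninv [set i] P = nlt i P.
Proof. by rewrite /ninv big_set1. Qed.

Lemma nlt1 i j : nlt i [set j] = (enum_rank j < enum_rank i)%N.
Proof. by rewrite nltE big_set1. Qed.

Lemma gen_anti i j : gen i * gen j = - (gen j * gen i).
Proof.
have [->|nij] := eqVneq i j; first by rewrite gen_sq oppr0.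
rewrite !mul_bas !disjoints1 !inE (eq_sym j) (negPf nij) /=.
rewrite setUC !ninv1 !nlt1; case: ltngtP => [_|_|/ord_inj/enum_rank_inj jEi].
- by rewrite expr1 expr0 mulrN1z mulr1z.
- by rewrite expr1 expr0 mulrN1z mulr1z opprK.
- by rewrite jEi eqxx in nij.
Qed.

Lemma gen_bas i P :
  gen i * bas P = if i \in P then 0 else bas (i |: P) *~ (-1) ^+ nlt i P.
Proof. by rewrite mul_bas disjoints1 ninv1; case: (i \in P). Qed.

Lemma nltU1 i j P : j \notin P -> nlt i (j |: P) = (nlt i [set j] + nlt i P)%N.
Proof. by move=> jP; rewrite nltU ?disjoints1. Qed.

Lemma nltD1 i j P : j \in P -> nlt i P = (nlt i [set j] + nlt i (P :\ j))%N.
Proof. by move=> jP; rewrite -{1}(setD1K jP) nltU1 // !inE eqxx. Qed.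

Lemma signMK (V : zmodType) n : involutive (fun a : V => a *~ (-1) ^+ n).
Proof. by move=> a /=; rewrite -mulrzA -expr2 sqrr_sign mulr1z. Qed.

Lemma set_ind1 (K : {set I} -> Prop) : K set0 ->
  (forall i P, i \notin P -> K P -> K (i |: P)) -> forall P, K P.
Proof.
move=> K0 KU P; have [n] := ubnP #|P|; elim: n P => // n IHn P.
have [-> //|[i iP]] := set_0Vmem P; rewrite (cardsD1 i) iP ltnS => leP.
by rewrite -(setD1K iP); apply: KU; [rewrite !inE eqxx | apply: IHn].
Qed.

Section Lift.
Variables (A : nzRingType) (v : I -> A).
Hypotheses (v_sq : forall i, v i * v i = 0)
           (v_anti : forall i j, v i * v j = - (v j * v i)).

Lemma comm_prod i (a : pred I) (s : seq I) :
  v i * \prod_(j <- s | a j) v j =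
  ((\prod_(j <- s | a j) v j) * v i) *~ (-1) ^+ count a s.
Proof.
elim: s => [|j s IHs]; first by rewrite !big_nil mul1r mulr1.
rewrite !big_cons /=; case: (a j) => //=.
rewrite [LHS]mulrA (v_anti i j) mulNr -[v j * v i * _]mulrA IHs exprS mulN1r.
by rewrite mulrNz mulrzAr mulrA.
Qed.

Lemma enum_split i : exists s1 s2,
  [/\ enum I = s1 ++ i :: s2, i \notin s1, i \notin s2
    & forall P, nlt i P = count (mem P) s1].
Proof.
have rankE j : enum_rank j = index j (enum I) :> nat.
  rewrite -[in RHS](nth_enum_rank j j) index_uniq ?enum_uniq //.
  by rewrite -cardE ltn_ord.
have := mem_enum I i; rewrite inE => /splitPr.
case def_e: (enum I) / => [s1 s2]; exists s1, s2.
have := enum_uniq I; rewrite def_e cat_uniq /= negb_or.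
case/and4P=> _ /andP[ns1 hs] ns2 _; split=> // P.
have rank_i : enum_rank i = size s1 :> nat by rewrite rankE def_e index_pivot.
rewrite nltE [index_enum I]unlock -enumT def_e big_cat big_cons /= ltnn add0n.
rewrite big_seq_cond (eq_bigr (fun=> 1%N)) => [|j /andP[js1 _]]; last first.
  by rewrite rank_i rankE def_e index_cat js1 index_mem js1.
rewrite -big_seq_cond sum1_count if_same big1_seq ?addn0 // => j /andP[_ js2].
rewrite rank_i rankE def_e index_cat; case: ifP => js1; last first.
  by rewrite ltnNge leq_addr.
by have := enum_uniq I; rewrite def_e cat_uniq => /and3P[_ /hasPn/(_ j)];
  rewrite inE js2 orbT js1 => /(_ isT).
Qed.

Lemma prod_insert i P : v i * \prod_(j in P) v j =
  if i \in P then 0 else (\prod_(j in i |: P) v j) *~ (-1) ^+ nlt i P.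
Proof.
have [s1 [s2 [def_e ns1 ns2 ->]]] := enum_split i.
have prodE Q : \prod_(j in Q) v j = \prod_(j <- s1 ++ i :: s2 | j \in Q) v j.
  by rewrite -def_e enumT [index_enum I]unlock.
rewrite !prodE !big_cat !big_cons /= mulrA comm_prod mulrzAl -!mulrA.
case: ifP => iP; first by rewrite (mulrA (v i)) v_sq mul0r mulr0 mul0rz.
rewrite setU11; congr (_ * (_ * _) *~ _).
  rewrite big_seq_cond [RHS]big_seq_cond; apply: eq_bigl => j.
  by rewrite !inE; case: eqP => // ->; rewrite (negPf ns1).
rewrite big_seq_cond [RHS]big_seq_cond; apply: eq_bigl => j.
by rewrite !inE; case: eqP => // ->; rewrite (negPf ns2).
Qed.

Lemma prod_mul P Q : \prod_(i in P) v i * \prod_(i in Q) v i =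
  if [disjoint P & Q] then (\prod_(i in P :|: Q) v i) *~ (-1) ^+ ninv P Q else 0.
Proof.
move: P; apply: set_ind1 => [|i P iP IHP].
  by rewrite big_set0 mul1r -setI_eq0 set0I eqxx set0U ninv0P.
have -> : \prod_(j in i |: P) v j = (v i * \prod_(j in P) v j) *~ (-1) ^+ nlt i P.
  by rewrite prod_insert (negPf iP) signMK.
rewrite mulrzAl -mulrA IHP disjointUl disjoints1.
have [dPQ|_] := boolP [disjoint P & Q]; last by rewrite andbF mulr0 mul0rz.
rewrite andbT mulrzAr prod_insert inE (negPf iP) /=.
case: (i \in Q) => /=; first by rewrite !mul0rz.
rewrite nltU // ninvUl ?disjoints1 // ninv1 setUA -!mulrzA -!exprD.
rewrite -[in LHS]signr_odd -[in RHS]signr_odd !oddD.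
by do 3!case: odd.
Qed.

Lemma lift_gen i : ex_lift v (gen i) = v i.
Proof. by rewrite /ex_lift lin_bas big_set1. Qed.

Lemma lift1 : ex_lift v 1 = 1.
Proof. by rewrite -bas0 /ex_lift lin_bas big_set0. Qed.

Lemma liftM : {morph ex_lift v : x y / x * y}.
Proof.
rewrite /ex_lift; move=> x y; move: x y.
apply: ex_ind => [P|x x' H H' y]; last by rewrite mulrBl !raddfB /= mulrBl H H'.
apply: ex_ind => [Q|y y' H H']; last by rewrite mulrBr !raddfB /= mulrBr H H'.
rewrite mul_bas !lin_bas prod_mul; case: ifP => _; last by rewrite raddf0.
by rewrite raddfMz /= lin_bas.
Qed.
End Lift.

Lemma bas_prod P : bas P = \prod_(i in P) gen i.
Proof.
move: P; apply: set_ind1 => [|i P iP IHP]; first by rewrite big_set0.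
apply: (can_inj (signMK (nlt i P))) => /=.
have := gen_bas i P; rewrite (negPf iP) => <-.
by rewrite IHP (prod_insert gen_sq gen_anti) (negPf iP).
Qed.

Lemma lift_unique (A : nzRingType) (v : I -> A) (f : {rmorphism Ex I -> A}) :
  (forall i, f (gen i) = v i) -> f =1 ex_lift v.
Proof.
move=> fv; apply: additive_eq => P; rewrite /= /ex_lift lin_bas bas_prod rmorph_prod.
by apply: eq_bigr.
Qed.

Lemma thetaB i : {morph theta i : x y / x - y}.
Proof. exact: raddfB. Qed.

Lemma theta_gen i j : theta i (gen j) = (i == j)%:R.
Proof.
rewrite /theta lin_bas inE; case: eqP => // <-.
by rewrite setDv nlt1 ltnn.
Qed.

Lemma theta_gen_mul i j y :
  theta i (gen j * y) = y *~ (i == j) - gen j * theta i y.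
Proof.
move: y; apply: ex_ind => [P|x y H H']; last first.
  rewrite mulrBr !thetaB mulrBr H H' mulrzBl.
  by rewrite !opprD addrACA.
rewrite /theta lin_bas gen_bas; case: eqP => [->|/eqP nij] /=.
  case: ifP => jP.
    rewrite raddf0 mulrzAr gen_bas !inE eqxx /= setD1K //.
    by rewrite (nltD1 j jP) nlt1 ltnn signMK subrr.
  rewrite mulr0 subr0 raddfMz /= lin_bas setU11 setU1K ?jP //.
  by rewrite nltU1 ?jP // nlt1 ltnn signMK.
rewrite mulr0z add0r; have [jP|jP] := boolP (j \in P).
  rewrite raddf0; case: ifP; rewrite ?mulr0 ?oppr0 // mulrzAr gen_bas.
  by rewrite !inE jP eq_sym nij mul0rz oppr0.
rewrite raddfMz /= lin_bas !inE (negPf nij) /=.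
case: ifP => iP; last by rewrite mulr0 mul0rz oppr0.
rewrite mulrzAr gen_bas !inE (negPf jP) andbF.
have -> : (j |: P) :\ i = j |: P :\ i.
  by apply/setP => k; rewrite !inE; case: (k =P j) => // ->; rewrite eq_sym nij.
have signS n : - ((-1) ^+ n) = (-1) ^+ n.+1 :> int by rewrite exprS mulN1r.
rewrite -!mulrzA -!exprD -mulrNz signS; congr (_ *~ _).
rewrite nltU1 // (nltD1 j iP) !nlt1 -[LHS]signr_odd -[RHS]signr_odd !(oddD, oddS).
have : enum_rank i != enum_rank j by rewrite (inj_eq enum_rank_inj).
rewrite -val_eqE /=; case: ltngtP => //= _ _; do 2!case: odd => //.
Qed.

Lemma theta_bas_mul i P y :
  theta i (bas P * y) = theta i (bas P) * y + (bas P * theta i y) *~ (-1) ^+ #|P|.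
Proof.
move: P y; apply: set_ind1 => [|j P jP IHP] y.
  by rewrite /theta lin_bas inE mul0r add0r cards0 !bas0 !mul1r.
have -> : bas (j |: P) = (gen j * bas P) *~ (-1) ^+ nlt j P.
  by rewrite gen_bas (negPf jP) signMK.
have thetaZ x n : theta i (x *~ n) = theta i x *~ n by rewrite /theta raddfMz.
rewrite !mulrzAl !thetaZ !mulrzAl -!mulrzA [(-1) ^+ nlt j P * _]mulrC mulrzA.
rewrite -mulrzDl; congr (_ *~ _).
rewrite -mulrA !theta_gen_mul IHP mulrBl mulrzAl cardsU1 jP exprS mulN1r mulrNz.
by rewrite mulrDr opprD addrA mulrzAr !mulrA.
Qed.

Lemma theta_deriv i (n : nat) x y : Ex_hom n%:Z x ->
  theta i (x * y) = theta i x * y + (x * theta i y) *~ (-1) ^+ n.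
Proof.
have thetaZ z k : theta i (z *~ k) = theta i z *~ k by rewrite /theta raddfMz.
have theta_sum (F : {set I} -> Ex I) : theta i (\sum_P F P) = \sum_P theta i (F P).
  by rewrite /theta raddf_sum.
move=> hx; pose c P := x P; have Dx : x = \sum_P bas P *~ c P := ex_decomp x.
have hc P : c P != 0 -> #|P| = n by move/(hx P) => [].
clear hx; clearbody c; rewrite Dx.
rewrite [X in theta i X]mulr_suml !theta_sum !mulr_suml mulrz_suml -big_split.
apply: eq_bigr => P _ /=; rewrite !mulrzAl !thetaZ !mulrzAl.
have [-> | /hc <-] := eqVneq (c P) 0; first by rewrite !mulr0z mul0rz addr0.
by rewrite theta_bas_mul mulrzDl -!mulrzA mulrC.
Qed.
End ExteriorTheory.

Section LiftTheory.
Variables (I : finType) (A B : nzRingType).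

Lemma lift_bas (v : I -> A) P : ex_lift v (bas P) = \prod_(i in P) v i.
Proof. exact: lin_bas. Qed.

Lemma liftB (v : I -> A) : {morph ex_lift v : x y / x - y}.
Proof. exact: raddfB. Qed.

Lemma liftMz (v : I -> A) x n : ex_lift v (x *~ n) = ex_lift v x *~ n.
Proof. exact: raddfMz. Qed.

Lemma lift_prod (v : I -> A) (T : Type) (r : seq T) (a : pred T) (F : T -> Ex I) :
    (forall i, v i * v i = 0) -> (forall i j, v i * v j = - (v j * v i)) ->
  ex_lift v (\prod_(t <- r | a t) F t) = \prod_(t <- r | a t) ex_lift v (F t).
Proof.
by move=> v_sq v_anti; apply: big_morph; [apply: liftM | apply: lift1].
Qed.

End LiftTheory.

Lemma Ex_map_prod (I J : finType) (f : I -> J) (T : Type) (r : seq T)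
    (a : pred T) (F : T -> Ex I) :
  Ex_map f (\prod_(t <- r | a t) F t) = \prod_(t <- r | a t) Ex_map f (F t).
Proof. by apply: lift_prod => *; [apply: gen_sq | apply: gen_anti]. Qed.

(* Membership in the span of the unit; [x set0] is the coefficient of 1. *)
Definition unit_span (I : finType) : {pred Ex I} :=
  fun x => x == 1 *~ x set0.
Arguments unit_span : clear implicits.

Fact unit_span_zmod_closed (I : finType) : zmod_closed (unit_span I).
Proof.
split=> [|x y]; first by rewrite -topredE /= /unit_span ffunE.
rewrite -!topredE /= /unit_span exD exN => /eqP Dx /eqP Dy.
by rewrite mulrzBr -Dx -Dy.
Qed.
HB.instance Definition _ (I : finType) :=
  GRing.isZmodClosed.Build (Ex I) (unit_span I) (unit_span_zmod_closed I).

Definition Pasc_mod (I : finType) : zmodType := Quotient.quot (unit_span I).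

Definition cls (I : finType) (x : Ex I) : Pasc_mod I :=
  \pi_(Quotient.quot (unit_span I)) x.

Definition rep (I : finType) (u : Pasc_mod I) : Ex I :=
  repr (u : Quotient.quot (unit_span I)).

Definition Pasc_hom (I : finType) (n : int) (u : Pasc_mod I) : Prop :=
  exists2 x : Ex I, Ex_hom (n + 1) x & u = cls x.

Definition Pasc_d (I : finType) (u : Pasc_mod I) : Pasc_mod I :=
  cls (Ex_d (rep u)).

Definition Pasc_act (I J : finType) (f : I -> J) (u : Pasc_mod I) : Pasc_mod J :=
  cls (Ex_map f (rep u)).

(* The ring morphism from Ex(I + J) to Ex((I \ {i}) + J) killing the generator
   i; on elements not involving that generator it is the canonical
   identification, see [forgetK]. *)
Definition forget_gen (I J : finType) (i : I) (k : I + J) : Ex (ins_type J i) :=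
  match k with
  | inl a => if insub a is Some a' then gen (inl a' : ins_type J i) else 0
  | inr b => gen (inr b : ins_type J i)
  end.

Definition forget (I J : finType) (i : I) : Ex (I + J)%type -> Ex (ins_type J i) :=
  ex_lift (forget_gen i).

Definition incl (I J : finType) (i : I) (k : ins_type J i) : (I + J)%type :=
  match k with inl a => inl (val a) | inr b => inr b end.

Definition comp_bas (I J : finType) (i : I) (P : {set I}) (Q : {set J}) :
    Ex (ins_type J i) :=
  let x := Ex_map inl (bas P) in
  let y := Ex_map inr (bas Q) in
  if i \in P then forget i (theta (inl i) (x * y)) *~ (-1) ^+ #|P|.-1
  else if #|Q| == 1%N then forget i x else 0.

(* The bilinear extension of [comp_bas] from the bases indexed by the non-empty
   subsets; [Pasc_comp_wedge] gives its value on monomials written in any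
   order. *)
Definition Pasc_comp (I J : finType) (i : I) (u : Pasc_mod I) (w : Pasc_mod J) :
    Pasc_mod (ins_type J i) :=
  cls (\sum_(P : {set I} | P != set0) \sum_(Q : {set J} | Q != set0)
         comp_bas i P Q *~ (rep u P * rep w Q)).

Definition Pasc_cplx (I : finType) : dgmod :=
  @DGMod (Pasc_mod I) (@Pasc_hom I) (@Pasc_d I).

Definition Pasc : operad_data :=
  @OperadData (fun I => Pasc_cplx I)
    (fun I J f => @Pasc_act I J f)
    (fun I J i => @Pasc_comp I J i)
    (cls (gen tt)).

Section PascClass.
Variable I : finType.
Implicit Types (x : Ex I) (i : I) (P : {set I}).

Lemma clsB : {morph @cls I : x x' / x - x'}.
Proof. exact: raddfB. Qed.

Lemma clsMz x n : cls (x *~ n) = cls x *~ n.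
Proof. exact: raddfMz. Qed.

Lemma cls_eq x x' : cls x = cls x' <-> exists n : int, x = x' + 1 *~ n.
Proof.
rewrite /cls; split=> [/eqP|[n ->]].
  rewrite -Quotient.idealrBE -topredE /= => /eqP Dx.
  by exists ((x - x') set0); rewrite -Dx addrC subrK.
apply/eqP; rewrite -Quotient.idealrBE -topredE /= /unit_span.
by rewrite addrAC subrr add0r exMz bas_eq intz.
Qed.

Lemma rep_cls x : exists n : int, rep (cls x) = x + 1 *~ n.
Proof. by apply/cls_eq; apply: reprK. Qed.

Lemma theta1 i : theta i 1 = 0.
Proof. by rewrite -bas0 /theta lin_bas inE. Qed.

Lemma Pasc_dE x : Pasc_d (cls x) = cls (Ex_d x).
Proof.
rewrite /Pasc_d; have [n ->] := rep_cls x; congr cls; apply: eq_bigr => i _.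
by rewrite /theta raddfD raddfMz /= -/(theta i 1) theta1 mul0rz addr0.
Qed.

Lemma rep_clsE x P : P != set0 -> rep (cls x) P = x P.
Proof.
move=> nP; have [n ->] := rep_cls x.
by rewrite exD exMz bas_neq // mul0rz addr0.
Qed.

End PascClass.

Section PascTheory.
Variables I J : finType.
Implicit Types (x : Ex I) (i : I).

Lemma Pasc_actE (f : I -> J) x : Pasc_act f (cls x) = cls (Ex_map f x).
Proof.
rewrite /Pasc_act; have [n ->] := rep_cls x; apply/cls_eq; exists n.
by rewrite /Ex_map /ex_lift raddfD raddfMz /= -/(ex_lift _ 1) lift1.
Qed.

Lemma forget_gen_sq i (k : I + J) : forget_gen i k * forget_gen i k = 0.
Proof.
by case: k => [a|b] /=; [case: insub => [?|]|]; rewrite ?gen_sq ?mul0r.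
Qed.

Lemma forget_gen_anti i (k l : I + J) :
  forget_gen i k * forget_gen i l = - (forget_gen i l * forget_gen i k).
Proof.
by case: k => [a|b]; case: l => [c|d] /=;
  do ?[case: insub => [?|]]; rewrite ?mul0r ?mulr0 ?oppr0 // gen_anti.
Qed.

Lemma forgetK i : cancel (Ex_map (@incl I J i)) (forget i).
Proof.
apply: ex_ind => [P|x y Hx Hy]; last first.
  by rewrite -[RHS](congr2 (fun a b => a - b) Hx Hy) /forget /Ex_map !liftB.
rewrite /Ex_map lift_bas /forget lift_prod; last 2 first.
- exact: forget_gen_sq.
- exact: forget_gen_anti.
rewrite bas_prod; apply: eq_bigr => k _; rewrite lift_gen.
by case: k => [a|b] //=; rewrite valK.
Qed.

End PascTheory.

Definition wedge (I : finType) (s : seq I) : Ex I := \prod_(i <- s) gen i.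

Lemma wedge_bas (I : finType) (s : seq I) :
  uniq s -> exists n, wedge s = bas [set k in s] *~ (-1) ^+ n.
Proof.
elim: s => [_|k s IHs /= /andP[ks /IHs[n Ds]]].
  by exists 0%N; rewrite /wedge big_nil expr0 mulr1z -bas0; congr bas;
    apply/setP=> k; rewrite !inE.
rewrite /wedge big_cons -/(wedge s) Ds mulrzAr gen_bas inE (negPf ks).
exists (nlt k [set j in s] + n)%N; rewrite exprD mulrzA.
by have -> : [set j in k :: s] = k |: [set j in s] by apply/setP=> j; rewrite !inE.
Qed.

Lemma wedge_map (I J : finType) (f : I -> J) (s : seq I) :
  wedge [seq f k | k <- s] = Ex_map f (wedge s).
Proof.
rewrite /wedge Ex_map_prod big_map; apply: eq_bigr => k _.
by rewrite /Ex_map lift_gen.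
Qed.

Lemma sum_bas (I J : finType) (V : zmodType) (F : {set I} -> {set J} -> V)
    (P : {set I}) (Q : {set J}) m n : P != set0 -> Q != set0 ->
  \sum_(R : {set I} | R != set0) \sum_(S : {set J} | S != set0)
    F R S *~ (rep (cls (bas P *~ m)) R * rep (cls (bas Q *~ n)) S) =
  F P Q *~ (m * n).
Proof.
have repE (T : finType) (R S : {set T}) c :
    R != set0 -> rep (cls (bas S *~ c)) R = (R == S)%:R *~ c.
  by move=> nR; rewrite rep_clsE // exMz ffunE.
move=> nP nQ; rewrite (bigD1 P) // (bigD1 Q) //= !repE // !eqxx !intz.
rewrite [X in _ + X + _]big1 => [|S /andP[nS /negPf SQ]]; last first.
  by rewrite repE // SQ mul0rz mulr0.
rewrite [X in _ + X]big1 ?addr0 // => R /andP[nR /negPf RP].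
by rewrite big1 // => S nS; rewrite (repE _ R) // RP mul0rz mul0r.
Qed.

Lemma Pasc_comp_bas (I J : finType) (i : I) (P : {set I}) (Q : {set J}) m n :
    P != set0 -> Q != set0 ->
  Pasc_comp i (cls (bas P *~ m)) (cls (bas Q *~ n)) =
  cls (comp_bas i P Q) *~ (m * n).
Proof. by move=> nP nQ; rewrite /Pasc_comp sum_bas // clsMz. Qed.

Lemma Pasc_comp_wedge (I J : finType) (i : I) (s : seq I) (t : seq J) :
    (0 < size s)%N -> (0 < size t)%N -> uniq s -> uniq t ->
  Pasc_comp i (cls (wedge s)) (cls (wedge t)) =
  let x := wedge [seq inl k | k <- s] in
  let y := wedge [seq inr k | k <- t] in
  if i \in s then
    cls (forget i (theta (inl i) (x * y))) *~ (-1) ^+ (size s).-1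
  else if size t == 1%N then cls (forget i x) else 0.
Proof.
move=> s_gt0 t_gt0 s_uniq t_uniq; rewrite !wedge_map /=.
have [m ->] := wedge_bas s_uniq; have [n Dt] := wedge_bas t_uniq; rewrite Dt.
have set_neq0 (T : finType) (r : seq T) : (0 < size r)%N -> [set k in r] != set0.
  by case: r => // k r _; apply/set0Pn; exists k; rewrite !inE eqxx.
have card_set (T : finType) (r : seq T) : uniq r -> #|[set k in r]| = size r.
  by rewrite cardsE => /card_uniqP.
have thetaZ (T : finType) (k : T) z c : theta k (z *~ c) = theta k z *~ c.
  exact: raddfMz.
rewrite Pasc_comp_bas ?set_neq0 // /comp_bas inE !card_set //.
rewrite /Ex_map !liftMz -!/(Ex_map _ _) mulrzAl mulrzAr -mulrzA.
case: ifP => _.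
  rewrite thetaZ /forget !liftMz !clsMz -!mulrzA.
  by rewrite [(-1) ^+ n * _]mulrC [_ * (_ * (-1) ^+ n)]mulrC.
case: ifP => [/eqP t1|_]; last by rewrite /cls raddf0 mul0rz.
suff -> : (-1) ^+ n = 1 :> int by rewrite mulr1 /forget liftMz clsMz.
case: t t1 Dt {t_gt0 t_uniq} => [|j []] //= _ Dt.
have := congr1 (fun z : Ex J => z [set j]) Dt; rewrite /wedge big_seq1.
by rewrite exMz (_ : [set k in [:: j]] = [set j]) ?bas_eq ?intz //;
  apply/setP=> k; rewrite !inE.
Qed.

(* Main.v *)
From HB Require Import structures.
From mathcomp Require Import all_boot all_order all_algebra.
From mathcomp Require Import zify.
Require Import Defs.

Set Implicit Arguments.
Unset Strict Implicit.
Unset Printing Implicit Defensive.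

Import Order.TTheory GRing.Theory Num.Theory.
Local Open Scope ring_scope.

(** Composing at i is a substitution. Write x = x' ^ e_i + x'' with x' and x''
    free of e_i. The sign in the definition is such that

      x o_i y = x' ^ y + (eps y) x'',

    where [eps y] is the coefficient sum of the degree one part of y, that is,
    the constant term of d y. Substituting y and then z for generators of x in
    either order gives the same result up to the order of the factors, which is
    why the operad axioms hold.

    To have identities between operators rather than between monomials, x' is
    written as the grade involution of the contraction of x by i, and x'' as the
    image of x under the ring morphism [kill] sending e_i to 0. The formula so
    obtained, [ex_comp], is bilinear and free of signs, and computes the composition
    as soon as y has no constant term ([Pasc_compE]). Each axiom then follows
    from the rules by which contractions, the differential, the grade involution
    and ring morphisms commute. The contractions are anticommuting derivations
    of square zero that anticommute with the differential and the grade
    involution, and d (kill x) = kill (d x) - kill (theta i x). These rules are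
    proved by letting both sides pass a generator ([ex_gen_ind]), and equalities
    of ring morphisms by comparing values on generators ([rmorph_eq]).

    A constant term of x changes the formula by a constant only, but y has to be
    represented without constant term. In the Leibniz rule ([Ex_d_ex_comp]) the
    constant term of d y is therefore dropped, and this matches the contraction
    of e_i in d x. Homogeneity is used for the Koszul signs: the
    grade involution is (-1)^(m + 1) in dimension m, and exchanging y and z in the
    parallel axiom uses the graded commutativity of the exterior algebra. *)

(** * Ring morphisms out of the exterior algebra *)

(** Multiplying by generators one at a time reaches every basis element up to
    sign, so identities between linear operators are checked by seeing how the
    operators commute past a generator; the signs hidden in [bas] never show. *)
Lemma ex_gen_ind (I : finType) (K : Ex I -> Prop) :
    K 1 -> (forall i x, K x -> K (gen i * x)) ->
    (forall x y, K x -> K y -> K (x - y)) ->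
  forall x, K x.
Proof.
move=> K1 KM KB; have K0 : K 0 by rewrite -(subrr 1); apply: KB.
have KN x : K x -> K (- x) by rewrite -[- x]add0r; apply: KB.
have Ksign x n : K x -> K (x *~ (-1) ^+ n).
  by rewrite -signr_odd; case: odd => // /KN; rewrite expr1 mulrN1z.
apply: ex_ind => // P; move: P; apply: set_ind1 => // i P iP KP.
suff -> : bas (i |: P) = gen i * bas P *~ (-1) ^+ nlt i P by exact/Ksign/KM.
by rewrite gen_bas (negPf iP) signMK.
Qed.

Lemma rmorph_eq (I : finType) (A : nzRingType) (f g : {rmorphism Ex I -> A}) :
  (forall i, f (gen i) = g (gen i)) -> f =1 g.
Proof.
by move=> fg x; rewrite (lift_unique fg) -(lift_unique (fun i => erefl (g (gen i)))).
Qed.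

Lemma lift_monoid_morphism (I : finType) (A : nzRingType) (v : I -> A) :
    (forall i, v i * v i = 0) -> (forall i j, v i * v j = - (v j * v i)) ->
  monoid_morphism (ex_lift v).
Proof. by move=> v_sq v_anti; split; [exact: lift1 | exact: liftM]. Qed.

Lemma Ex_map_monoid_morphism (I J : finType) (f : I -> J) :
  monoid_morphism (Ex_map f).
Proof. by apply: lift_monoid_morphism => *; [exact: gen_sq | exact: gen_anti]. Qed.
HB.instance Definition _ (I J : finType) (f : I -> J) :=
  GRing.isZmodMorphism.Build (Ex I) (Ex J) (Ex_map f) (liftB _).
HB.instance Definition _ (I J : finType) (f : I -> J) :=
  GRing.isMonoidMorphism.Build (Ex I) (Ex J) (Ex_map f) (Ex_map_monoid_morphism f).

Lemma forget_monoid_morphism (I J : finType) (i : I) :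
  monoid_morphism (@forget I J i).
Proof.
by apply: lift_monoid_morphism => *; [exact: forget_gen_sq | exact: forget_gen_anti].
Qed.
HB.instance Definition _ (I J : finType) (i : I) :=
  GRing.isZmodMorphism.Build _ _ (@forget I J i) (liftB _).
HB.instance Definition _ (I J : finType) (i : I) :=
  GRing.isMonoidMorphism.Build _ _ (@forget I J i) (@forget_monoid_morphism I J i).

(** The image in Ex((I \ {i}) + J) of an element of Ex(I) modulo [gen i]. As it
    is defined on all of Ex(I) and multiplicative, one need not restrict to
    elements free of [gen i] before transporting them. *)
Definition kill (I J : finType) (i : I) : Ex I -> Ex (ins_type J i) :=
  @forget I J i \o Ex_map inl.
HB.instance Definition _ (I J : finType) (i : I) :=
  GRing.RMorphism.copy (@kill I J i) (@forget I J i \o Ex_map inl).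
Arguments kill {I} J i.

(** The grade involution x |-> (-1)^(deg x) x. Koszul signs enter the
    formulas through it, which keeps them meaningful for inhomogeneous x. *)
Definition ginv (I : finType) : Ex I -> Ex I := ex_lift (fun i => - gen i).
Arguments ginv {I}.

Lemma ginv_monoid_morphism (I : finType) : monoid_morphism (@ginv I).
Proof.
apply: lift_monoid_morphism => [i|i j]; rewrite !mulrNN ?gen_sq //; exact: gen_anti.
Qed.
HB.instance Definition _ (I : finType) :=
  GRing.isZmodMorphism.Build (Ex I) (Ex I) ginv (liftB _).
HB.instance Definition _ (I : finType) :=
  GRing.isMonoidMorphism.Build (Ex I) (Ex I) ginv (ginv_monoid_morphism I).

Definition aug (I : finType) (x : Ex I) : int := x set0.

Lemma augB (I : finType) : zmod_morphism (@aug I).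
Proof. by move=> x y; rewrite /aug exD exN. Qed.
HB.instance Definition _ (I : finType) :=
  GRing.isZmodMorphism.Build (Ex I) int (@aug I) (@augB I).

Lemma aug_bas (I : finType) (P : {set I}) : aug (bas P) = (P == set0)%:R.
Proof. by rewrite /aug ffunE eq_sym. Qed.

Lemma aug_monoid_morphism (I : finType) : monoid_morphism (@aug I).
Proof.
split=> [|x y]; first by rewrite -bas0 aug_bas eqxx.
move: x y; apply: ex_ind => [P|x x' H H' y]; last first.
  by rewrite mulrBl !raddfB /= mulrBl H H'.
apply: ex_ind => [Q|y y' H H']; last by rewrite mulrBr !raddfB /= mulrBr H H'.
rewrite mul_bas !aug_bas -natrM mulnb -setU_eq0.
case: ifP => dPQ; last first.
  rewrite raddf0; case: eqP => // /eqP; rewrite setU_eq0 => /andP[/eqP P0 _].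
  by move: dPQ; rewrite P0 -setI_eq0 set0I eqxx.
rewrite raddfMz /= aug_bas; case: eqP => [|_]; last by rewrite mul0rz.
move/eqP; rewrite setU_eq0 => /andP[/eqP-> _].
by rewrite ninv0P.
Qed.
HB.instance Definition _ (I : finType) :=
  GRing.isMonoidMorphism.Build (Ex I) int (@aug I) (@aug_monoid_morphism I).

HB.instance Definition _ (I : finType) (i : I) :=
  GRing.isZmodMorphism.Build (Ex I) (Ex I) (theta i) (@thetaB I i).

Lemma Ex_dB (I : finType) : zmod_morphism (@Ex_d I).
Proof. by move=> x y; rewrite /Ex_d -sumrB; apply: eq_bigr => i _; rewrite raddfB. Qed.
HB.instance Definition _ (I : finType) :=
  GRing.isZmodMorphism.Build (Ex I) (Ex I) (@Ex_d I) (@Ex_dB I).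

(** The sum of the coefficients of the degree one part: the factor by which
    y acts when it is inserted at an index that does not occur in x. *)
Definition eps (I : finType) : Ex I -> int := @aug I \o @Ex_d I.
HB.instance Definition _ (I : finType) :=
  GRing.Additive.copy (@eps I) (@aug I \o @Ex_d I).

(** * Contractions, the grade involution and the differential *)

Section Exterior.
Variable I : finType.
Implicit Types (x y z : Ex I) (i j k : I).

Lemma theta_gen_mulE i j x :
  theta i (gen j * x) = (if i == j then x else 0) - gen j * theta i x.
Proof. by rewrite theta_gen_mul; case: eqP; rewrite ?mulr0z. Qed.

Lemma ginv_gen i : ginv (gen i) = - gen i.
Proof.
apply: lift_gen.
Qed.

Lemma ginv_gen_mul i x : ginv (gen i * x) = - (gen i * ginv x).
Proof. by rewrite rmorphM /= ginv_gen mulNr. Qed.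

Lemma ginvK : involutive (@ginv I).
Proof.
apply: (rmorph_eq (f := ginv \o ginv) (g := idfun)) => i /=.
by rewrite ginv_gen raddfN /= ginv_gen opprK.
Qed.

Lemma theta_mul i x y : theta i (x * y) = theta i x * y + ginv x * theta i y.
Proof.
move: x; apply: ex_gen_ind => [|j x IHx|x x' H H'].
- by rewrite theta1 rmorph1 !mul1r mul0r add0r.
- rewrite -mulrA !theta_gen_mulE IHx ginv_gen_mul.
  rewrite mulrBl mulrDr opprD addrA !mulrA mulNr; congr (_ - _ - _).
  by case: eqP; rewrite ?mul0r.
- by rewrite mulrBl !raddfB /= H H' !mulrBl opprD addrACA.
Qed.

Lemma theta_ginv i x : theta i (ginv x) = - ginv (theta i x).
Proof.
move: x; apply: ex_gen_ind => [|j x IHx|x x' H H'].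
- by rewrite rmorph1 theta1 raddf0 oppr0.
- rewrite ginv_gen_mul raddfN /= !theta_gen_mulE IHx.
  rewrite (raddfB (@ginv I)) /= ginv_gen_mul mulrN.
  by case: eqP => _; rewrite ?raddf0.
- by rewrite !raddfB /= H H'.
Qed.

Lemma theta_anti i j x : theta i (theta j x) = - theta j (theta i x).
Proof.
move: x; apply: ex_gen_ind => [|k x IHx|x x' H H'].
- by rewrite !theta1 !raddf0.
- have thE a b : theta a (theta b (gen k * x)) =
      (if b == k then theta a x else 0) - (if a == k then theta b x else 0)
        + gen k * theta a (theta b x).
    rewrite theta_gen_mulE (raddfB (theta a)) /= theta_gen_mulE opprB addrA addrAC.
    by rewrite (fun_if (theta a)) (raddf0 (theta a)).
  by rewrite !thE IHx mulrN opprD opprB.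
- by rewrite !raddfB /= H H'.
Qed.

Lemma theta_sq i x : theta i (theta i x) = 0.
Proof.
move: x; apply: ex_gen_ind => [|k x IHx|x x' H H'].
- by rewrite theta1 raddf0.
- rewrite theta_gen_mulE (raddfB (theta i)) /= theta_gen_mulE IHx mulr0 subr0.
  by rewrite (fun_if (theta i)) (raddf0 (theta i)) subrr.
- by rewrite !raddfB /= H H' subrr.
Qed.

Lemma Ex_d_mul x y : Ex_d (x * y) = Ex_d x * y + ginv x * Ex_d y.
Proof.
rewrite /Ex_d mulr_suml mulr_sumr -big_split.
by apply: eq_bigr => i _; rewrite theta_mul.
Qed.

Lemma Ex_d_gen i : Ex_d (gen i) = 1.
Proof.
rewrite /Ex_d (bigD1 i) //= theta_gen eqxx big1 ?addr0 // => j /negPf nji.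
by rewrite theta_gen nji.
Qed.

Lemma Ex_d1 : Ex_d (1 : Ex I) = 0.
Proof. by rewrite /Ex_d big1 // => i _; rewrite theta1. Qed.

Lemma Ex_d_gen_mul i x : Ex_d (gen i * x) = x - gen i * Ex_d x.
Proof. by rewrite Ex_d_mul Ex_d_gen mul1r ginv_gen mulNr. Qed.

Lemma Ex_d_ginv x : Ex_d (ginv x) = - ginv (Ex_d x).
Proof.
rewrite /Ex_d (raddf_sum (@ginv I)) -sumrN.
by apply: eq_bigr => i _; rewrite theta_ginv.
Qed.

Lemma theta_Ex_d i x : theta i (Ex_d x) = - Ex_d (theta i x).
Proof.
rewrite /Ex_d (raddf_sum (theta i)) -sumrN.
by apply: eq_bigr => j _; exact: theta_anti.
Qed.

Lemma Ex_d_sq x : Ex_d (Ex_d x) = 0.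
Proof.
move: x; apply: ex_gen_ind => [|k x IHx|x x' H H'].
- by rewrite Ex_d1 raddf0.
- by rewrite Ex_d_gen_mul (raddfB (@Ex_d I)) /= Ex_d_gen_mul IHx mulr0 subr0 subrr.
- by rewrite !raddfB /= H H' subrr.
Qed.

Lemma aug_gen i : aug (gen i) = 0.
Proof. by rewrite aug_bas; case: eqP => // /setP/(_ i); rewrite !inE eqxx. Qed.

Lemma aug_ginv x : aug (ginv x) = aug x.
Proof.
apply: (rmorph_eq (f := @aug I \o ginv) (g := @aug I)) => i /=.
by rewrite ginv_gen raddfN /= aug_gen oppr0.
Qed.

(** [eps] is a derivation over the augmentation, being the augmentation of the
    derivation [Ex_d]. *)
Lemma eps_mul x y : eps (x * y) = eps x * aug y + aug x * eps y.
Proof.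
by rewrite /eps /= Ex_d_mul (raddfD (@aug I)) /= !(rmorphM (@aug I)) /= aug_ginv.
Qed.

End Exterior.

Section Maps.
Variables (I J : finType) (f : I -> J).
Implicit Types (x y : Ex I).

Lemma Ex_map_gen i : Ex_map f (gen i) = gen (f i).
Proof. exact: lift_gen. Qed.

Lemma ginv_map x : ginv (Ex_map f x) = Ex_map f (ginv x).
Proof.
apply: (rmorph_eq (f := ginv \o Ex_map f) (g := Ex_map f \o ginv)) => i /=.
by rewrite ginv_gen raddfN /= Ex_map_gen ginv_gen.
Qed.

Lemma aug_map x : aug (Ex_map f x) = aug x.
Proof.
apply: (rmorph_eq (f := @aug J \o Ex_map f) (g := @aug I)) => i /=.
by rewrite Ex_map_gen !aug_gen.
Qed.

Lemma Ex_d_map x : Ex_d (Ex_map f x) = Ex_map f (Ex_d x).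
Proof.
move: x; apply: ex_gen_ind => [|k x IHx|x x' H H'].
- by rewrite rmorph1 !Ex_d1 raddf0.
- rewrite rmorphM /= Ex_map_gen !Ex_d_gen_mul IHx (raddfB (Ex_map f)) /=.
  by rewrite rmorphM /= Ex_map_gen.
- by rewrite !raddfB /= H H'.
Qed.

Lemma eps_map x : eps (Ex_map f x) = eps x.
Proof. by rewrite /eps /= Ex_d_map aug_map. Qed.

Lemma theta_map_inj i x : injective f -> theta (f i) (Ex_map f x) = Ex_map f (theta i x).
Proof.
move=> f_inj; move: x; apply: ex_gen_ind => [|k x IHx|x x' H H'].
- by rewrite rmorph1 !theta1 raddf0.
- rewrite rmorphM /= Ex_map_gen !theta_gen_mulE IHx (raddfB (Ex_map f)) /=.
  by rewrite rmorphM /= Ex_map_gen (inj_eq f_inj); case: (i == k); rewrite ?raddf0.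
- by rewrite !raddfB /= H H'.
Qed.

Lemma theta_map0 j x : (forall i, f i != j) -> theta j (Ex_map f x) = 0.
Proof.
move=> nfj; move: x; apply: ex_gen_ind => [|k x IHx|x x' H H'].
- by rewrite rmorph1 theta1.
- rewrite rmorphM /= Ex_map_gen theta_gen_mulE IHx mulr0 subr0.
  by rewrite eq_sym (negPf (nfj k)).
- by rewrite !raddfB /= H H' subrr.
Qed.
End Maps.

Lemma Ex_map_comp (I J K : finType) (g : J -> K) (f : I -> J) x :
  Ex_map (g \o f) x = Ex_map g (Ex_map f x).
Proof.
apply: (rmorph_eq (f := Ex_map (g \o f)) (g := Ex_map g \o Ex_map f)) => i /=.
by rewrite !Ex_map_gen.
Qed.

Lemma Ex_map_eq (I J : finType) (f g : I -> J) : f =1 g -> Ex_map f =1 Ex_map g.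
Proof. by move=> fg x; apply: rmorph_eq => i /=; rewrite !Ex_map_gen fg. Qed.

Lemma Ex_map_id (I : finType) (x : Ex I) : Ex_map id x = x.
Proof. by apply: (rmorph_eq (f := Ex_map id) (g := idfun)) => i /=; rewrite Ex_map_gen. Qed.

(** * Killing a generator *)

Section Kill.
Variables (I J : finType) (i : I).
Implicit Types (x : Ex I).

Lemma kill_gen_neq k (ki : k != i) :
  kill J i (gen k) = gen (inl (exist _ k ki) : ins_type J i).
Proof.
rewrite /kill /= Ex_map_gen [LHS]lift_gen /=.
by case: insubP => [u _ uk|]; rewrite ?ki //; congr (gen (inl _)); apply: val_inj.
Qed.

Lemma kill_gen : kill J i (gen i) = 0.
Proof.
by rewrite /kill /= Ex_map_gen [LHS]lift_gen /= insubF ?eqxx.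
Qed.

Lemma ginv_kill x : ginv (kill J i x) = kill J i (ginv x).
Proof.
apply: (rmorph_eq (f := ginv \o kill J i) (g := kill J i \o ginv)) => k /=.
rewrite ginv_gen raddfN /=; have [->|ki] := eqVneq k i.
  by rewrite kill_gen raddf0 oppr0.
by rewrite kill_gen_neq ginv_gen.
Qed.

Lemma aug_kill x : aug (kill J i x) = aug x.
Proof.
apply: (rmorph_eq (f := @aug _ \o kill J i) (g := @aug I)) => k /=.
rewrite aug_gen; have [->|ki] := eqVneq k i; first by rewrite kill_gen raddf0.
by rewrite kill_gen_neq aug_gen.
Qed.

Lemma kill_gen_mul_eq x : kill J i (gen i * x) = 0.
Proof. by rewrite rmorphM /= kill_gen mul0r. Qed.

Lemma theta_kill_inl k (ki : k != i) x :
  theta (inl (exist _ k ki) : ins_type J i) (kill J i x) = kill J i (theta k x).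
Proof.
move: x; apply: ex_gen_ind => [|l x IHx|x x' H H'].
- by rewrite rmorph1 !theta1 raddf0.
- rewrite theta_gen_mulE (raddfB (kill J i)) /=.
  have [->|li] := eqVneq l i.
    by rewrite !kill_gen_mul_eq (negPf ki) !raddf0 addr0.
  rewrite !rmorphM /= kill_gen_neq theta_gen_mulE IHx; congr (_ - _).
  rewrite (fun_if (kill J i)) (raddf0 (kill J i)).
  by congr (if _ then _ else _).
- by rewrite !raddfB /= H H'.
Qed.

Lemma theta_kill_inr j x : theta (inr j : ins_type J i) (kill J i x) = 0.
Proof.
move: x; apply: ex_gen_ind => [|l x IHx|x x' H H'].
- by rewrite rmorph1 !theta1.
- have [->|li] := eqVneq l i; first by rewrite kill_gen_mul_eq raddf0.
  by rewrite !rmorphM /= kill_gen_neq theta_gen_mulE IHx mulr0 subrr.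
- by rewrite !raddfB /= H H' subrr.
Qed.

(** The differential is the sum of all contractions; in the image of [kill J i]
    the contraction by i is missing from that sum. *)
Lemma Ex_d_kill x : Ex_d (kill J i x) = kill J i (Ex_d x) - kill J i (theta i x).
Proof.
move: x; apply: ex_gen_ind => [|l x IHx|x x' H H'].
- by rewrite rmorph1 !Ex_d1 theta1 raddf0 subrr.
- rewrite Ex_d_gen_mul theta_gen_mulE !(raddfB (kill J i)) /=.
  have [->|li] := eqVneq l i; first by rewrite !kill_gen_mul_eq raddf0 subr0 subrr.
  rewrite !rmorphM /= kill_gen_neq Ex_d_gen_mul IHx raddf0 sub0r.
  by rewrite mulrBr opprB opprK addrA addrAC.
- by rewrite !raddfB /= H H' opprD addrACA.
Qed.

End Kill.

Lemma killN (I J : finType) (i : I) x : kill J i (- x) = - kill J i x.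
Proof. exact: raddfN. Qed.

Lemma killMz (I J : finType) (i : I) x n : kill J i (x *~ n) = kill J i x *~ n.
Proof. exact: raddfMz. Qed.

Lemma mapD (I J : finType) (f : I -> J) x y : Ex_map f (x + y) = Ex_map f x + Ex_map f y.
Proof. exact: raddfD. Qed.

Lemma mapMz (I J : finType) (f : I -> J) x n : Ex_map f (x *~ n) = Ex_map f x *~ n.
Proof. exact: raddfMz. Qed.

Lemma mapM (I J : finType) (f : I -> J) x y : Ex_map f (x * y) = Ex_map f x * Ex_map f y.
Proof. exact: rmorphM. Qed.

(** * Homogeneous elements and signs *)

Section Homogeneous.
Variable I : finType.
Implicit Types (x y : Ex I) (P Q : {set I}) (m n : int).

Lemma hom_bas P : Ex_hom #|P| (bas P).
Proof. by move=> Q; rewrite ffunE; have [->//|] := eqVneq Q P. Qed.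

Lemma Ex_hom0 n : Ex_hom n (0 : Ex I).
Proof. by move=> P; rewrite ffunE eqxx. Qed.

Lemma Ex_homB n x y : Ex_hom n x -> Ex_hom n y -> Ex_hom n (x - y).
Proof.
move=> hx hy P; rewrite exD exN; have [xP|/hx //] := eqVneq (x P) 0.
by rewrite xP sub0r oppr_eq0 => /hy.
Qed.

Lemma Ex_homMz n x k : Ex_hom n x -> Ex_hom n (x *~ k).
Proof.
by move=> hx P; rewrite exMz => nz; apply: hx; apply: contraNneq nz => ->; rewrite mul0rz.
Qed.

Lemma Ex_homD n x y : Ex_hom n x -> Ex_hom n y -> Ex_hom n (x + y).
Proof.
move=> hx hy; rewrite -[y]opprK -[- y]sub0r.
by apply: Ex_homB => //; apply: Ex_homB => //; apply: Ex_hom0.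
Qed.

Lemma hom_ind n (K : Ex I -> Prop) : K 0 ->
    (forall P, #|P|%:Z = n -> K (bas P)) ->
    (forall x y, K x -> K y -> K (x - y)) ->
  forall x, Ex_hom n x -> K x.
Proof.
move=> K0 Kb KB x hx.
have KN y : K y -> K (- y) by rewrite -[- y]add0r; apply: KB.
have KD y z : K y -> K z -> K (y + z) by rewrite -{2}[z]opprK => /KB H /KN /H.
rewrite (ex_decomp x); elim/big_ind: _ => // P _.
have [->|/hx hP] := eqVneq (x P) 0; first by rewrite mulr0z.
have Kn k : K (bas P *+ k).
  by elim: k => [|k IHk]; rewrite ?mulr0n // mulrS; apply: KD => //; apply: Kb.
by case: (x P) => k; [apply: Kn | rewrite NegzE mulrNz; apply/KN/Kn].
Qed.

Lemma Ex_hom_mul m n x y : Ex_hom m x -> Ex_hom n y -> Ex_hom (m + n) (x * y).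
Proof.
move=> hx hy; move: x hx; apply: hom_ind => [|P <-|x x' hx hx'].
- by rewrite mul0r; apply: Ex_hom0.
- move: y hy; apply: hom_ind => [|Q <-|y y' hy hy'].
  + by rewrite mulr0; apply: Ex_hom0.
  + rewrite mul_bas; case: ifP => dPQ; last exact: Ex_hom0.
    have /eqP cPQ : #|P :|: Q| == (#|P| + #|Q|)%N by rewrite (leq_card_setU P Q).2.
    by apply: Ex_homMz; rewrite -PoszD -cPQ; apply: hom_bas.
  + by rewrite mulrBr; apply: Ex_homB.
- by rewrite mulrBl; apply: Ex_homB.
Qed.

Lemma Ex_hom_theta n i x : Ex_hom n x -> Ex_hom (n - 1) (theta i x).
Proof.
move: x; apply: hom_ind => [|P <-|x x' hx hx'].
- by rewrite raddf0; apply: Ex_hom0.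
- rewrite /theta lin_bas; case: ifP => iP; last exact: Ex_hom0.
  by apply: Ex_homMz; rewrite (cardsD1 i P) iP PoszD addrC addKr; apply: hom_bas.
- by rewrite raddfB; apply: Ex_homB.
Qed.

Lemma Ex_hom_d n x : Ex_hom n x -> Ex_hom (n - 1) (Ex_d x).
Proof.
move=> hx; rewrite /Ex_d; elim/big_ind: _ => [|y z|i _].
- exact: Ex_hom0.
- exact: Ex_homD.
- exact: Ex_hom_theta.
Qed.

Lemma ginv_bas P : ginv (bas P) = bas P *~ (-1) ^+ #|P|.
Proof.
move: P; apply: set_ind1 => [|i P iP IHP]; first by rewrite bas0 rmorph1 cards0.
apply: (can_inj (signMK (nlt i P))) => /=.
rewrite -(raddfMz (@ginv I)) /= -!mulrzA mulrC mulrzA.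
have := gen_bas i P; rewrite (negPf iP) => <-.
by rewrite ginv_gen_mul IHP cardsU1 iP exprS mulN1r mulrNz mulrzAr.
Qed.

Lemma ginv_hom n x : Ex_hom n x -> ginv x = x *~ (-1) ^ n.
Proof.
move: x; apply: hom_ind => [|P <-|x x' hx hx']; first by rewrite raddf0 mul0rz.
- by rewrite ginv_bas.
- by rewrite raddfB /= hx hx' mulrzBl.
Qed.

Lemma eps_hom n x : Ex_hom n x -> n != 1 -> eps x = 0.
Proof.
move/Ex_hom_d => hd n1; apply/eqP; apply: contraNT n1 => /hd.
by rewrite cards0 => /esym/eqP; rewrite subr_eq0.
Qed.

Lemma eps_bas Q : eps (bas Q) = (#|Q| == 1%N)%:R.
Proof.
have [/cards1P[i ->]|n1] := boolP (_ == _).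
  by rewrite -/(gen i) /eps /= Ex_d_gen rmorph1.
by apply: (eps_hom (@hom_bas Q)).
Qed.

Lemma gen_comm i x : gen i * x = ginv x * gen i.
Proof.
move: x; apply: ex_gen_ind => [|k y IHy|y y' H H'].
- by rewrite rmorph1 mul1r mulr1.
- by rewrite mulrA gen_anti mulNr -mulrA IHy mulrA ginv_gen_mul mulNr.
- by rewrite mulrBr raddfB /= mulrBl H H'.
Qed.

Lemma bas_comm P x : bas P * x = iter #|P| ginv x * bas P.
Proof.
move: P; apply: set_ind1 => [|i P iP IHP]; first by rewrite bas0 mul1r cards0 mulr1.
apply: (can_inj (signMK (nlt i P))) => /=.
have := gen_bas i P; rewrite (negPf iP) -mulrzAl -mulrzAr => <-.
rewrite -mulrA IHP cardsU1 iP iterS !mulrA; congr (_ * _).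
exact: gen_comm.
Qed.

(** Graded commutativity: [bas P] passes an element at the cost of one grade
    involution per generator ([bas_comm]). *)
Lemma supercomm m n x y : Ex_hom m x -> Ex_hom n y ->
  x * y = (y * x) *~ (-1) ^ (m * n).
Proof.
move=> hx hy; move: x hx; apply: hom_ind => [|P <-|x x' hx hx'].
- by rewrite mul0r mulr0 mul0rz.
- rewrite bas_comm; suff -> : iter #|P| ginv y = y *~ (-1) ^ (#|P|%:Z * n).
    by rewrite mulrzAl.
  elim: #|P| => [|k IHk]; first by rewrite mul0r expr0z.
  rewrite iterS IHk raddfMz /= (ginv_hom hy) -mulrzA -exprzDr // intS.
  by rewrite mulrDl mul1r.
- by rewrite mulrBr mulrBl mulrzBl hx hx'.
Qed.

End Homogeneous.

Lemma Ex_hom_rmorph (I J : finType) (f : {rmorphism Ex I -> Ex J}) n x :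
  (forall i, Ex_hom 1 (f (gen i))) -> Ex_hom n x -> Ex_hom n (f x).
Proof.
move=> hf; move: x; apply: hom_ind => [|P <-|x x' hx hx'].
- by rewrite raddf0; apply: Ex_hom0.
- rewrite bas_prod rmorph_prod -sum1_card.
  elim/big_rec2: _ => [|i k y _ hy].
    by rewrite -bas0; rewrite -(cards0 J); apply: hom_bas.
  by rewrite PoszD; apply: Ex_hom_mul.
- by rewrite raddfB; apply: Ex_homB.
Qed.

Lemma hom_gen (I : finType) (i : I) : Ex_hom 1 (gen i).
Proof. by rewrite -[1%R]/(1%N%:Z) -(cards1 i); apply: hom_bas. Qed.

Lemma Ex_hom_map (I J : finType) (f : I -> J) n x : Ex_hom n x -> Ex_hom n (Ex_map f x).
Proof. by apply: Ex_hom_rmorph => i /=; rewrite Ex_map_gen; apply: hom_gen. Qed.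

Lemma Ex_hom_ginv (I : finType) n (x : Ex I) : Ex_hom n x -> Ex_hom n (ginv x).
Proof. by move=> hx; rewrite (ginv_hom hx); apply: Ex_homMz. Qed.

Lemma Ex_hom_kill (I J : finType) (i : I) n x : Ex_hom n x -> Ex_hom n (kill J i x).
Proof.
apply: Ex_hom_rmorph => k /=; have [->|ki] := eqVneq k i.
  by rewrite kill_gen; apply: Ex_hom0.
by rewrite kill_gen_neq; apply: hom_gen.
Qed.

(** * The complex Pasc(I) *)

HB.instance Definition _ (I : finType) :=
  GRing.isZmodMorphism.Build (Ex I) (Pasc_mod I) (@cls I) (@clsB I).

Section Class.
Variable I : finType.
Implicit Types (u w : Pasc_mod I) (x : Ex I) (P : {set I}).

Lemma repK u : cls (rep u) = u.
Proof. exact: reprK. Qed.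

Lemma cls1 : cls (1 : Ex I) = 0.
Proof. by rewrite -(raddf0 (@cls I)); apply/cls_eq; exists 1; rewrite add0r. Qed.

Lemma repB u w P : P != set0 -> rep (u - w) P = rep u P - rep w P.
Proof.
by move=> P0; rewrite -{1}[u]repK -{1}[w]repK -clsB rep_clsE // exD exN.
Qed.

Lemma rep_inj u w : (forall P, P != set0 -> rep u P = rep w P) -> u = w.
Proof.
move=> uw; rewrite -[u]repK -[w]repK; apply/cls_eq.
exists (rep u set0 - rep w set0); apply/ffunP=> P; rewrite exD exMz.
have [->|P0] := eqVneq P set0; first by rewrite bas_eq intz addrC subrK.
by rewrite bas_neq // mul0rz addr0 uw.
Qed.

(** The representative of [cls x] without constant term. *)
Definition reduce x : Ex I := x - 1 *~ aug x.

Lemma cls_reduce x : cls (reduce x) = cls x.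
Proof. by rewrite raddfB raddfMz /= cls1 mul0rz subr0. Qed.

Lemma aug_reduce x : aug (reduce x) = 0.
Proof. by rewrite raddfB raddfMz /= rmorph1 intz subrr. Qed.

Lemma reduce_id x : aug x = 0 -> reduce x = x.
Proof. by rewrite /reduce => ->; rewrite mulr0z subr0. Qed.

Lemma reduceB : zmod_morphism reduce.
Proof. by move=> x y; rewrite /reduce raddfB /= mulrzBr opprD addrACA -opprD. Qed.
HB.instance Definition _ :=
  GRing.isZmodMorphism.Build (Ex I) (Ex I) reduce reduceB.

Lemma Ex_hom_reduce n x : Ex_hom n x -> Ex_hom n (reduce x).
Proof.
move=> hx; have [x0|/hx] := eqVneq (aug x) 0; first by rewrite reduce_id.
rewrite cards0 => n0; apply: Ex_homB => //; apply: Ex_homMz.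
by rewrite -bas0 -n0 -(cards0 I); apply: hom_bas.
Qed.

Lemma cls_surj u : exists2 x, aug x = 0 & u = cls x.
Proof. by exists (reduce (rep u)); rewrite ?aug_reduce // cls_reduce repK. Qed.

Lemma Pasc_hom_cls n u :
  Pasc_hom n u -> exists2 x, Ex_hom (n + 1) x /\ aug x = 0 & u = cls x.
Proof.
case=> x hx ->; exists (reduce x); last by rewrite cls_reduce.
by split; [exact: Ex_hom_reduce | exact: aug_reduce].
Qed.

(** Degrees can be read off the coefficients, which makes the directness of the
    grading a statement about one coefficient at a time. *)
Lemma Pasc_homP n u :
  Pasc_hom n u <-> (forall P, P != set0 -> rep u P != 0 -> #|P|%:Z = n + 1).
Proof.
split=> [[x hx ->] P P0|hu]; first by rewrite rep_clsE // => /hx.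
exists (reduce (rep u)); last by rewrite cls_reduce repK.
move=> P; have [->|P0] := eqVneq P set0; first by rewrite [_ set0]aug_reduce.
rewrite exD exN exMz bas_neq // mul0rz subr0; exact: hu.
Qed.

(** The decomposition of u collects its coefficients by cardinality. *)
Lemma Pasc_complex : is_complex (Pasc_cplx I).
Proof.
split=> [n|n u w|u|r c r_uniq hc c0 n nr|u w|n u|u] /=.
- by exists 0; rewrite ?raddf0 //; apply: Ex_hom0.
- case=> x hx -> [y hy ->]; exists (x - y); last by rewrite raddfB.
  exact: Ex_homB.
- pose c (n : int) := cls (
    [ffun P : {set I} => if #|P|%:Z == n + 1 then rep u P else 0] : Ex I).
  (* A subset of cardinality k sits in degree k - 1. *)
  exists [seq k%:Z - 1 | k <- iota 0 #|I|.+1], c; split=> [n|].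
    eexists; last by []; move=> P; rewrite ffunE.
    by have [//|_] := eqVneq #|P|%:Z (n + 1); rewrite eqxx.
  rewrite /c -(raddf_sum (@cls I)) -[LHS]repK; congr cls; apply/ffunP=> P.
  rewrite sum_ffunE big_map (bigD1_seq #|P|) ?iota_uniq ?mem_iota //=; last first.
    by rewrite ltnS max_card.
  rewrite ffunE subrK eqxx big1 ?addr0 // => k /negPf kP.
  by rewrite ffunE subrK eqz_nat eq_sym kP.
- have repD v w P : P != set0 -> rep (v + w) P = rep v P + rep w P.
    by move=> P0; rewrite -{1}[v]repK -{1}[w]repK -raddfD /= rep_clsE // exD.
  have rep0 P : P != set0 -> rep (0 : Pasc_mod I) P = 0.
    by move=> P0; rewrite -(raddf0 (@cls I)) rep_clsE // ffunE.
  apply: rep_inj => P P0; rewrite rep0 //.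
  apply/eqP; apply: contraT => cn.
  have dP := (Pasc_homP _ _).1 (hc n) P P0 cn.
  have := congr1 (fun v => rep v P) c0; rewrite rep0 //.
  rewrite (big_morph (fun v : Pasc_mod I => rep v P) (fun v w => repD v w P P0)
    (rep0 P P0)).
  rewrite (bigD1_seq n) //= big1 ?addr0 => [/eqP|m mn]; first by rewrite (negPf cn).
  apply/eqP; apply: contraNT mn => /((Pasc_homP _ _).1 (hc m) P P0).
  by rewrite dP => /addIr->.
- rewrite -[u]repK -[w]repK -raddfD /= !Pasc_dE -raddfD; congr cls.
  exact: raddfD.
- case=> x hx ->; rewrite Pasc_dE; exists (Ex_d x) => //.
  by rewrite addrAC; apply: Ex_hom_d.
- by rewrite -[u]repK !Pasc_dE Ex_d_sq raddf0.
Qed.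
End Class.

(** * A sign-free formula for the composition *)

Section Comp.
Variables (I J : finType) (i : I).
Implicit Types (x : Ex I) (y : Ex J).

(** Write x = x' ^ e_i + x'' with x' and x'' free of e_i. Then x' is
    [ginv (theta i x)], since moving e_i to the front of x' ^ e_i costs the sign
    (-1)^(deg x'), and x'' is x modulo e_i; the composition substitutes y for
    the last factor e_i in the first term and multiplies the second by [eps y]. *)
Definition ex_comp x y : Ex (ins_type J i) :=
  kill J i (ginv (theta i x)) * Ex_map inr y + kill J i x *~ eps y.

Lemma ex_compBl y : {morph ex_comp^~ y : x x' / x - x'}.
Proof.
by move=> x x'; rewrite /ex_comp !raddfB /= mulrBl mulrzBl opprD addrACA.
Qed.

Lemma ex_compBr x : {morph ex_comp x : y y' / y - y'}.
Proof. by move=> y y'; rewrite /ex_comp !raddfB /= mulrBr opprD addrACA. Qed.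

Lemma Pasc_compBl w : {morph (@Pasc_comp I J i)^~ w : u u' / u - u'}.
Proof.
move=> u u'; rewrite /Pasc_comp -clsB -sumrB; congr cls.
apply: eq_bigr => P P0; rewrite -sumrB; apply: eq_bigr => Q _.
by rewrite repB // mulrBl mulrzBr.
Qed.

Lemma Pasc_compBr u : {morph @Pasc_comp I J i u : w w' / w - w'}.
Proof.
move=> w w'; rewrite /Pasc_comp -clsB -sumrB; congr cls.
apply: eq_bigr => P _; rewrite -sumrB; apply: eq_bigr => Q Q0.
by rewrite repB // mulrBr mulrzBr.
Qed.

(** The sign (-1)^(dim x) in the definition of the composition is the grade
    involution of the contraction of x, which has degree dim x. *)
Lemma comp_basE P Q : comp_bas i P Q = ex_comp (bas P) (bas Q).
Proof.
have killE x : forget i (Ex_map inl x) = kill J i x by [].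
have inrE y : forget i (Ex_map inr y) = Ex_map inr y.
  apply: (rmorph_eq (f := forget i \o Ex_map inr) (g := Ex_map inr)) => j /=.
  by rewrite !Ex_map_gen; apply: lift_gen.
rewrite /comp_bas /ex_comp eps_bas; case: ifPn => iP.
  have -> : kill J i (bas P) = 0.
    rewrite -(setD1K iP) -(signMK (nlt i (P :\ i)) (bas (i |: _))).
    have := gen_bas i (P :\ i); rewrite !inE eqxx /= => <-.
    by rewrite raddfMz /= kill_gen_mul_eq mul0rz.
  rewrite mul0rz addr0 theta_mul [X in _ + _ * X]theta_map0 // mulr0 addr0.
  rewrite theta_map_inj; last by move=> a b [].
  rewrite rmorphM /= killE inrE (ginv_hom (Ex_hom_theta (i := i) (@hom_bas _ P))).
  rewrite raddfMz /= mulrzAl; congr (_ *~ _).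
  by rewrite (cardsD1 i P) iP /= PoszD addrC addKr.
have -> : theta i (bas P) = 0 by rewrite /theta lin_bas (negPf iP).
rewrite !raddf0 mul0r add0r killE.
by case: eqP.
Qed.

(** A constant term of y would contribute the factor x', while one of x
    contributes only a constant; hence the hypothesis on y. *)
Lemma Pasc_compE x y : aug y = 0 -> Pasc_comp i (cls x) (cls y) = cls (ex_comp x y).
Proof.
move=> y0; rewrite -[in RHS](reduce_id y0); move: x y {y0}.
have cmp0l y : ex_comp 0 y = 0 by have := ex_compBl y 0 0; rewrite !subrr.
have cmp0r x : ex_comp x 0 = 0 by have := ex_compBr x 0 0; rewrite !subrr.
have comp0l (w : Pasc_mod J) : @Pasc_comp I J i 0 w = 0.
  by have := Pasc_compBl w 0 0; rewrite !subrr.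
have comp0r u : @Pasc_comp I J i u 0 = 0 by have := Pasc_compBr u 0 0; rewrite !subrr.
apply: ex_ind => [P y|x x' H H' y]; last by rewrite ex_compBl !clsB Pasc_compBl H H'.
move: y; apply: ex_ind => [Q|y y' H H']; last first.
  by rewrite reduceB ex_compBr !clsB Pasc_compBr H H'.
have [->|Q0] := eqVneq Q set0.
  by rewrite bas0 /reduce cls1 comp0r rmorph1 subrr cmp0r raddf0.
rewrite reduce_id; last by rewrite aug_bas (negPf Q0).
have [->|P0] := eqVneq P set0.
  rewrite bas0 cls1 comp0l /ex_comp theta1 !raddf0 mul0r add0r rmorph1.
  by rewrite clsMz cls1 mul0rz.
by have := Pasc_comp_bas i 1 1 P0 Q0; rewrite !mulr1z comp_basE.
Qed.
End Comp.

(** * The operad identities in the exterior algebra *)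

Section CompTheory.
Variables (I J : finType) (i : I).
Implicit Types (x : Ex I) (y : Ex J).

(** Ensures that a composite of normalized elements is normalized, so that
    [Pasc_compE] applies to iterated compositions. *)
Lemma aug_ex_comp x y : aug y = 0 -> aug (ex_comp i x y) = aug x * eps y.
Proof.
move=> y0; rewrite /ex_comp raddfD /= rmorphM /= aug_map y0 mulr0 add0r.
by rewrite raddfMz /= aug_kill -mulrzr intz.
Qed.

Lemma Ex_hom_ex_comp m n x y :
  Ex_hom (m + 1) x -> Ex_hom (n + 1) y -> Ex_hom (m + n + 1) (ex_comp i x y).
Proof.
move=> hx hy; apply: Ex_homD.
  rewrite -[m](addrK 1) -addrA; apply: Ex_hom_mul; last exact: Ex_hom_map.
  exact/Ex_hom_kill/Ex_hom_ginv/Ex_hom_theta.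
have [n0|n1] := eqVneq (n + 1) 1; last by rewrite (eps_hom hy n1) mulr0z; apply: Ex_hom0.
move/(canRL (addrK 1)): n0; rewrite subrr => ->; rewrite addr0.
exact/Ex_homMz/Ex_hom_kill.
Qed.

(** The Leibniz rule. The constant term of d y, dropped by [reduce], is [eps y];
    it accounts for the term of d(kill x) where e_i itself is contracted. *)
Lemma Ex_d_ex_comp x y :
  Ex_d (ex_comp i x y) = ex_comp i (Ex_d x) y - ex_comp i (ginv x) (reduce (Ex_d y)).
Proof.
have eps1 n : eps (1 *~ n : Ex J) = 0 by rewrite raddfMz /= /eps /= Ex_d1 raddf0 mul0rz.
have epsd : eps (reduce (Ex_d y)) = 0.
  by rewrite /reduce raddfB /= eps1 subr0 /eps /= Ex_d_sq raddf0.
rewrite /ex_comp epsd mulr0z addr0 raddfD /= raddfMz /= Ex_d_mul !Ex_d_kill Ex_d_map.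
rewrite ginv_kill theta_ginv theta_sq !raddf0 addr0 Ex_d_ginv theta_Ex_d theta_ginv.
rewrite !(raddfN (@ginv I)) !(raddfN (kill J i)) /= ginvK.
rewrite /reduce (raddfB (Ex_map inr)) (raddfMz (Ex_map inr)) /= rmorph1.
rewrite -[aug _]/(eps y) [in X in _ = _ - X]mulNr opprK mulrBr mulrzr mulrzBl.
by rewrite -!addrA; congr (_ + _); rewrite [RHS]addrCA.
Qed.
End CompTheory.

(** Equivariance: every ingredient of [ex_comp] commutes with relabelling, the
    contraction because f is injective. *)
Lemma ex_comp_map (I I' J J' : finType) (f : bij I I') (g : bij J J') (i : I) x y :
  Ex_map (ins_bij f g i) (ex_comp i x y) = ex_comp (f i) (Ex_map f x) (Ex_map g y).
Proof.
have killE a : Ex_map (ins_bij f g i) (kill J i a) = kill J' (f i) (Ex_map f a).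
  apply: (rmorph_eq (f := Ex_map (ins_bij f g i) \o kill J i)
                    (g := kill J' (f i) \o Ex_map f)) => k /=.
  rewrite Ex_map_gen; have [->|ki] := eqVneq k i; first by rewrite !kill_gen raddf0.
  by rewrite (kill_gen_neq J ki) Ex_map_gen (kill_gen_neq J' (bij_neq f ki)).
rewrite /ex_comp raddfD /= rmorphM raddfMz /= !killE eps_map -!Ex_map_comp.
by rewrite (theta_map_inj _ _ (can_inj (bfunK f))) ginv_map.
Qed.

Lemma ex_compMzl (I J : finType) (i : I) (x : Ex I) (y : Ex J) n :
  ex_comp i (x *~ n) y = ex_comp i x y *~ n.
Proof.
rewrite /ex_comp (raddfMz (theta i)) (raddfMz (@ginv I)) !killMz mulrzAl mulrzDl.
by rewrite -!mulrzA [n * _]mulrC.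
Qed.

Section Seq.
Variables (I J K : finType) (i : I) (j : J).

(** Sequential associativity. Contracting [ex_comp i x y] by j only touches y, which
    leaves the product of three factors on both sides; the remaining terms
    agree because [eps] is multiplicative along the composition ([epsE]). *)
Lemma ex_comp_seq (x : Ex I) (y : Ex J) (z : Ex K) : aug y = 0 -> aug z = 0 ->
  Ex_map (seq_bij K i j) (ex_comp (inr j : ins_type J i) (ex_comp i x y) z) =
  ex_comp i x (ex_comp j y z).
Proof.
move=> y0 z0; set S := seq_bij K i j.
have killxE a : Ex_map S (kill K (inr j) (kill J i a)) = kill _ i a.
  apply: (rmorph_eq (f := Ex_map S \o kill K (inr j : ins_type J i) \o kill J i)
                    (g := kill _ i)) => k /=.
  have [->|ki] := eqVneq k i; first by rewrite !kill_gen !raddf0.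
  by rewrite !kill_gen_neq Ex_map_gen.
have killyE a : Ex_map S (kill K (inr j) (Ex_map inr a)) = Ex_map inr (kill K j a).
  apply: (rmorph_eq (f := Ex_map S \o kill K (inr j : ins_type J i) \o Ex_map inr)
                    (g := Ex_map inr \o kill K j)) => k /=.
  rewrite Ex_map_gen; have [->|kj] := eqVneq k j; first by rewrite !kill_gen !raddf0.
  by rewrite !kill_gen_neq !Ex_map_gen.
have SzE : Ex_map S (Ex_map inr z) = Ex_map inr (Ex_map inr z).
  by rewrite -!Ex_map_comp.
have epsE : eps (ex_comp j y z) = eps y * eps z.
  rewrite /ex_comp raddfD raddfMz /= eps_mul eps_map aug_map z0 mulr0 add0r.
  rewrite aug_kill aug_ginv -mulrzr intz -mulrDl; congr (_ * _).
  by rewrite [X in _ + X]/eps /= Ex_d_kill raddfB /= !aug_kill addrC subrK.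
rewrite /ex_comp -/(ex_comp j y z) epsE.
rewrite [theta (inr j) _]raddfD raddfMz /= theta_mul !theta_kill_inr mul0r add0r.
rewrite mul0rz addr0 theta_map_inj; last by move=> a b [].
rewrite ginv_kill ginvK [ginv (_ * _)]rmorphM /= ginv_kill ginv_map.
do 3!rewrite ?raddfD /= ?rmorphM /= ?raddfMz /=.
rewrite !killxE !killyE SzE.
by rewrite mulrzDl mulrDr mulrA mulrzAr -mulrzA addrA.
Qed.
End Seq.

Lemma sign_cases (a : int) : (-1) ^ a = 1 :> int \/ (-1) ^ a = -1 :> int.
Proof.
have sgn (k : nat) : (-1) ^+ k = 1 :> int \/ (-1) ^+ k = -1 :> int.
  by rewrite -signr_odd; case: odd; [right | left].
case: a => k; first exact: sgn.
by rewrite NegzE -exprnN; case: (sgn k.+1) => ->; [left | right].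
Qed.

(** The signs of parallel associativity: exchanging the factors Y and Z, of
    degrees m + 1 and n + 1, moving each past the generator that the other one
    replaces and exchanging these two generators gives the exponent
    (m + 1) (n + 1) + (m + 1) + (n + 1) + 1 = m n mod 2. The other terms carry
    e or e', and then m n = 0. *)
Lemma par_identity (R : nzRingType) (A B C D A' B' C' D' Y Z : R) (m n e e' : int) :
    Z * Y = (Y * Z) *~ (-1) ^ ((n + 1) * (m + 1)) ->
    m = 0 \/ e = 0 -> n = 0 \/ e' = 0 ->
    A = A' -> B = B' -> C = C' -> D = D' ->
  (- (A * (Y *~ (-1) ^ (m + 1))) + B *~ e) * Z + (C * Y + D *~ e) *~ e' =
  ((- (- A' * (Z *~ (-1) ^ (n + 1))) + C' *~ e') * Y + (B' * Z + D' *~ e') *~ e)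
    *~ (-1) ^ (m * n).
Proof.
move=> ZY me ne <- <- <- <-; rewrite !mulrzAr.
have qe : e * (-1) ^ (m * n) = e by case: me => ->; rewrite ?mul0r // expr0z mulr1.
have qe' : e' * (-1) ^ (m * n) = e'.
  by case: ne => ->; rewrite ?mul0r // mulr0 expr0z mulr1.
have sgn : - (-1) ^ (m + 1) =
    (-1) ^ ((n + 1) * (m + 1)) * ((-1) ^ (n + 1) * (-1) ^ (m * n)) :> int.
  rewrite mulrDl mul1r mulrDr mulr1 [n * m]mulrC !exprzDr // !expr1z.
  by case: (sign_cases (m * n)) => ->; case: (sign_cases m) => ->;
    case: (sign_cases n) => ->.
rewrite [- A * Z]mulNr mulNrz opprK !mulrDl !mulrzDl mulNr !mulrzAl -[A * Z * Y]mulrA ZY.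
rewrite -!(mulrzA _ e (_ ^ _)) -(mulrzA _ e' (_ ^ _)) qe qe' mulrzAr mulrA -!mulrzA -sgn.
rewrite mulrNz [e' * e]mulrC -!addrA; congr (_ + _).
by rewrite addrCA.
Qed.

Section Par.
Variables (I J K : finType) (i k : I) (ki : k != i) (ik : i != k).

(** Contracting at an index k other than i acts on x alone. *)
Lemma ginv_theta_ex_comp (I' J' : finType) (i' k' : I') (ki' : k' != i')
    (x : Ex I') (y : Ex J') :
  ginv (theta (keepl J' ki') (ex_comp i' x y)) =
  - (kill J' i' (theta k' (theta i' x)) * Ex_map inr (ginv y))
    + kill J' i' (ginv (theta k' x)) *~ eps y.
Proof.
rewrite /ex_comp (raddfD (theta _)) (raddfMz (theta _)) /= theta_mul !theta_kill_inl.
rewrite [X in _ + _ * X]theta_map0 // mulr0 addr0 theta_ginv (raddfN (kill _ _)) /= mulNr.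
rewrite (raddfD (@ginv _)) (raddfMz (@ginv _)) (raddfN (@ginv _)) /=.
rewrite (rmorphM (@ginv _)) /=.
by rewrite !ginv_kill ginv_map ginvK.
Qed.

(** Parallel associativity seen through two morphisms to a common ring that agree
    on Ex(I). Both sides then have the same four terms, the one with both
    substitutions involving [theta k (theta i x)] and [theta i (theta k x)],
    which are opposite. *)
Lemma par_morph (R : nzRingType) (Phi : {rmorphism Ex (ins_type J i) -> R})
    (Psi : {rmorphism Ex (ins_type K k) -> R}) m n (x : Ex I) (y : Ex J) (z : Ex K) :
    Ex_hom (m + 1) y -> Ex_hom (n + 1) z ->
    (forall a, Phi (kill J i a) = Psi (kill K k a)) ->
    Psi (Ex_map inr z) * Phi (Ex_map inr y) =
      (Phi (Ex_map inr y) * Psi (Ex_map inr z)) *~ (-1) ^ ((n + 1) * (m + 1)) ->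
  Phi (ginv (theta (keepl J ki) (ex_comp i x y))) * Psi (Ex_map inr z)
    + Phi (ex_comp i x y) *~ eps z =
  (Psi (ginv (theta (keepl K ik) (ex_comp k x z))) * Phi (Ex_map inr y)
    + Psi (ex_comp k x z) *~ eps y) *~ (-1) ^ (m * n).
Proof.
move=> hy hz PhiE ZY; rewrite !ginv_theta_ex_comp (ginv_hom hy) (ginv_hom hz) /ex_comp.
rewrite !mapMz (theta_anti i k) killN !(raddfD Phi) !(raddfD Psi) /=.
rewrite (raddfN Phi) (raddfN Psi) /= (raddfMz Phi) (raddfMz Psi) /=.
rewrite !(rmorphM Phi) !(rmorphM Psi) !(raddfMz Phi) !(raddfMz Psi) /=.
rewrite (raddfN Psi) /=; move: {ZY}(Phi (Ex_map inr y)) (Psi (Ex_map inr z)) ZY => Y Z ZY.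
apply: par_identity ZY _ _ (PhiE _) (PhiE _) (PhiE _) (PhiE _).
- by have [->|m0] := eqVneq m 0; [left | right; apply: (eps_hom hy); lia].
- by have [->|n0] := eqVneq n 0; [left | right; apply: (eps_hom hz); lia].
Qed.

Lemma ex_comp_par m n (x : Ex I) (y : Ex J) (z : Ex K) :
    Ex_hom (m + 1) y -> Ex_hom (n + 1) z ->
  Ex_map (par_bij ki ik J K) (ex_comp (keepl J ki) (ex_comp i x y) z) =
  ex_comp (keepl K ik) (ex_comp k x z) y *~ (-1) ^ (m * n).
Proof.
move=> hy hz; set S := par_bij ki ik J K.
have killxE a : Ex_map S (kill K (keepl J ki) (kill J i a)) =
               kill J (keepl K ik) (kill K k a).
  apply: (rmorph_eq (f := Ex_map S \o kill K (keepl J ki) \o kill J i)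
                    (g := kill J (keepl K ik) \o kill K k)) => l /=.
  have [->|li] := eqVneq l i.
    by rewrite kill_gen !raddf0 kill_gen_neq kill_gen.
  have [->|lk] := eqVneq l k.
    by rewrite kill_gen !raddf0 kill_gen_neq kill_gen raddf0.
  by rewrite !kill_gen_neq Ex_map_gen.
have killyE a : Ex_map S (kill K (keepl J ki) (Ex_map inr a)) = Ex_map inr a.
  apply: (rmorph_eq (f := Ex_map S \o kill K (keepl J ki) \o Ex_map inr)
                    (g := Ex_map inr)) => l /=.
  by rewrite Ex_map_gen kill_gen_neq !Ex_map_gen.
have SzE a : Ex_map S (Ex_map inr a) = kill J (keepl K ik) (Ex_map inr a).
  apply: (rmorph_eq (f := Ex_map S \o Ex_map inr)
                    (g := kill J (keepl K ik) \o Ex_map inr)) => l /=.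
  by rewrite !Ex_map_gen kill_gen_neq.
rewrite {1}/ex_comp [in RHS]/ex_comp mapD mapM mapMz SzE -killyE.
apply: (par_morph (Phi := Ex_map S \o kill K (keepl J ki))
                  (Psi := kill J (keepl K ik))) => //=.
by rewrite killyE; apply/supercomm; [apply/Ex_hom_kill/Ex_hom_map | apply: Ex_hom_map].
Qed.
End Par.

Lemma ex_comp_1l (J : finType) (y : Ex J) :
  Ex_map (unitl_bij J) (ex_comp (tt : one_set) (gen tt) y) = y.
Proof.
rewrite /ex_comp theta_gen eqxx !rmorph1 mul1r kill_gen mul0rz addr0 -Ex_map_comp.
exact: Ex_map_id.
Qed.

(** The decomposition x = x' ^ e_i + x'' inside Ex(I), with p in the role of
    reduction modulo e_i. *)
Lemma gen_expansion (I : finType) (i : I) (p : {rmorphism Ex I -> Ex I}) x :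
    p (gen i) = 0 -> (forall k, k != i -> p (gen k) = gen k) ->
  p (ginv (theta i x)) * gen i + p x = x.
Proof.
move=> p_i p_k.
have p_ginv a : p (ginv a) = ginv (p a).
  apply: (rmorph_eq (f := p \o ginv) (g := ginv \o p)) => k /=.
  rewrite ginv_gen raddfN /=; have [->|ki] := eqVneq k i.
    by rewrite p_i !raddf0.
  by rewrite p_k // ginv_gen.
move: x; apply: ex_gen_ind => [|k x IHx|x x' H H'].
- by rewrite theta1 (raddf0 (@ginv I)) (raddf0 p) mul0r add0r rmorph1.
- rewrite theta_gen_mulE (raddfB (@ginv I)) /= ginv_gen_mul opprK.
  rewrite (raddfD p) /= !(rmorphM p) /=.
  have [->|ki] := eqVneq k i.
    (* Here e_i x' e_i vanishes, as e_i commutes past x' up to sign. *)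
    rewrite p_i !mul0r !addr0 -[in RHS]IHx mulrDr mulrA gen_comm.
    rewrite -mulrA gen_sq mulr0 add0r.
    by rewrite gen_comm p_ginv.
  rewrite p_k // (raddf0 (@ginv I)) (raddf0 p) add0r.
  by rewrite -[in RHS]IHx mulrDr mulrA.
- rewrite (raddfB (theta i)) /= (raddfB (@ginv I)) /= !(raddfB p) /= mulrBl addrACA.
  by rewrite -opprD H H'.
Qed.

Lemma ex_comp_1r (I : finType) (i : I) (x : Ex I) :
  Ex_map (unitr_bij i) (ex_comp i x (gen tt)) = x.
Proof.
have eps1 : eps (gen tt) = 1 by rewrite /eps /= Ex_d_gen rmorph1.
have pgenE : Ex_map (unitr_bij i) (Ex_map inr (gen tt)) = gen i by rewrite !Ex_map_gen.
rewrite /ex_comp eps1 mulr1z mapD mapM pgenE.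
apply: (gen_expansion (p := Ex_map (unitr_bij i) \o kill unit i)) => [|k ki] /=.
  by rewrite kill_gen raddf0.
by rewrite (kill_gen_neq _ ki) Ex_map_gen.
Qed.

(** * The operad Pasc *)

Lemma morphB_D (U V : zmodType) (f : U -> V) :
  {morph f : x y / x - y} -> {morph f : x y / x + y}.
Proof.
move=> fB x y; have f0 : f 0 = 0 by have := fB 0 0; rewrite !subrr.
have fN z : f (- z) = - f z by rewrite -sub0r fB f0 sub0r.
by rewrite -{1}[y]opprK fB fN opprK.
Qed.

Lemma clsD (I : finType) : {morph @cls I : x y / x + y}.
Proof. exact: raddfD. Qed.

Lemma Pasc_act_chain (I J : finType) (f : I -> J) :
  @is_chain_map (Pasc_cplx I) (Pasc_cplx J) (Pasc_act f).
Proof.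
split=> [u w|n u|u] /=.
- by rewrite -[u]repK -[w]repK -(raddfD (@cls I)) /= !Pasc_actE mapD -(raddfD (@cls J)).
- by case=> x hx ->; exists (Ex_map f x); rewrite ?Pasc_actE //; apply: Ex_hom_map.
- by rewrite -[u]repK Pasc_dE !Pasc_actE Pasc_dE Ex_d_map.
Qed.

(** For x of dimension m the grade involution is the sign (-1)^(m + 1), which
    turns the minus sign of [Ex_d_ex_comp] into the Koszul sign (-1)^m. *)
Lemma Pasc_comp_chain (I J : finType) (i : I) :
  @is_chain_bimap (Pasc_cplx I) (Pasc_cplx J) (Pasc_cplx (ins_type J i)) (Pasc_comp i).
Proof.
split=> [w|u|m n u w|m u w] /=.
- exact/morphB_D/Pasc_compBl.
- exact/morphB_D/Pasc_compBr.
- case=> x hx -> /Pasc_hom_cls[y [hy y0] ->].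
  by exists (ex_comp i x y); [apply: Ex_hom_ex_comp | rewrite Pasc_compE].
- case=> x hx ->; have [y y0 ->] := cls_surj w.
  rewrite Pasc_compE // !Pasc_dE Pasc_compE // -[cls (Ex_d y)]cls_reduce.
  rewrite Pasc_compE ?aug_reduce // Ex_d_ex_comp (ginv_hom hx).
  by rewrite ex_compMzl exprzDr // expr1z mulrN1 mulrNz opprK clsD !clsMz.
Qed.

Theorem proposition5 : is_dg_operad Pasc.
Proof.
split.
- by move=> I; apply: Pasc_complex.
- by move=> I J f; apply: Pasc_act_chain.
- move=> I J f g u fg; rewrite /= -[u]repK !Pasc_actE; congr cls.
  exact: Ex_map_eq.
- by move=> I u; rewrite /= -[u in LHS]repK Pasc_actE Ex_map_id repK.
- move=> I J K g f u; rewrite /= -[u]repK !Pasc_actE; congr cls.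
  exact: Ex_map_comp.
- by move=> I J i; apply: Pasc_comp_chain.
- move=> I I' J J' f g i u w; have [x x0 ->] := cls_surj u; have [y y0 ->] := cls_surj w.
  rewrite /= Pasc_compE // !Pasc_actE Pasc_compE ?aug_map //; congr cls.
  exact: ex_comp_map.
- by exists (gen tt) => //; apply: hom_gen.
- by rewrite /= Pasc_dE Ex_d_gen cls1.
- move=> I J K i j u v w; have [x x0 ->] := cls_surj u.
  have [y y0 ->] := cls_surj v; have [z z0 ->] := cls_surj w.
  rewrite /= !Pasc_compE ?aug_ex_comp ?y0 ?mul0r // Pasc_actE; congr cls.
  exact: ex_comp_seq.
- move=> I J K i k ki ik m n u v w hv hw; have [x x0 ->] := cls_surj u.
  have [y [hy y0] ->] := Pasc_hom_cls hv; have [z [hz z0] ->] := Pasc_hom_cls hw.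
  rewrite /= !Pasc_compE // Pasc_actE -clsMz; congr cls.
  exact: ex_comp_par.
- move=> J w; have [y y0 ->] := cls_surj w.
  rewrite /= Pasc_compE // Pasc_actE; congr cls; exact: ex_comp_1l.
- move=> I i u; have [x x0 ->] := cls_surj u.
  rewrite /= Pasc_compE ?aug_gen // Pasc_actE; congr cls; exact: ex_comp_1r.
Qed.
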